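(* Let $V$ be a real vector space of dimension $n$, $M\subset V$ a lattice, and $P\subset V$ an $n$-dimensional lattice polytope (not necessarily simple). Let $\varphi\colon V\to\mathbb{C}$ be a nonzero homogeneous polynomial function of degree $\deg\varphi$. For each nonempty face $F$ of $P$ let $D_{\varphi,F}(q)$ be the polynomial in $q$ equal to $\sum_{m\in M\cap qF}\varphi(m)$ for all positive integers $q$, and define \[ G_\varphi(q,y):=(y+1)^{\deg\varphi}\sum_{F}(y+1)^{\dim F}(-y)^{n-\dim F}\,D_{\varphi,F}(q)\,\tilde g_F\!\left(-\tfrac1y\right), \] the sum over all nonempty faces $F$ of $P$. Then, as rational functions of $q,y$, \[ G_\varphi(q,y)=(-y)^{n+\deg\varphi}\,G_\varphi\!\left(-q,\tfrac1y\right). \]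
   Context: Lattice polytope: vertices in $M$. For a face $F$ of $P$, $\tilde g_F(x):=g_{P^\diamond(F)}(x)$, where $P^\diamond(F)$ is the face of the polar polytope of $P$ dual to $F$ (its face poset is the interval $[F,P]$ of the face poset of $P$ with order reversed; $P^\diamond(P)$ is the empty face). The $g$-polynomial is defined recursively: for the empty face, $f=g=1$; if $\dim Q=k\ge 0$ then $f_Q(x)=\sum_{F}g_F(x)(x-1)^{k-1-\dim F}$, summed over all proper faces $F$ of $Q$ including the empty face (of dimension $-1$), and writing $f_Q=\sum_{l=0}^k f_lx^l$, $m=\lfloor k/2\rfloor$, one sets $g_Q(x)=f_0+(f_1-f_0)x+\dots+(f_m-f_{m-1})x^m$. (If $P$ is simple, all $\tilde g_F=1$.) *)

(* Defs.v *)
From mathcomp Require Import all_boot all_algebra.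
From mathcomp Require Import boolp classical_sets fsbigop reals.
From mathcomp Require Import complex.
From mathcomp Require Import mpoly.

Set Implicit Arguments.
Unset Strict Implicit.
Unset Printing Implicit Defensive.

Import GRing.Theory Num.Theory.
Local Open Scope ring_scope.

Section LatticePolytope.
Variables (R : realType) (n k : nat).

Definition dotv (c x : 'rV[R]_n) : R := (x *m c^T) 0 0.

Definition lat (B : 'M[R]_n) (z : 'rV[int]_n) : 'rV[R]_n :=
  map_mx (fun a : int => a%:~R) z *m B.
Definition in_lattice (B : 'M[R]_n) (x : 'rV[R]_n) : Prop :=
  exists z : 'rV[int]_n, x = lat B z.

(* P = conv { v i | i < k.+1 }  (a nonempty polytope given by finitely many
   points; it is a lattice polytope when all v i lie in M). *)
Variable v : 'I_k.+1 -> 'rV[R]_n.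

(* Nonempty faces of P are indexed by the set of the points v i they contain:
   T is (the index set of) a face iff T is the argmax set of some linear
   functional c (c = 0 gives P itself, T = setT). The face is conv(v T). *)
Definition is_face (T : {set 'I_k.+1}) : Prop :=
  exists c : 'rV[R]_n,
    T = [set i | [forall j, dotv c (v j) <= dotv c (v i)]].
Definition faceb (T : {set 'I_k.+1}) : bool := `[< is_face T >].

Definition affdim (T : {set 'I_k.+1}) : nat :=
  (\rank (\matrix_(i < k.+1)
            (if i \in T then row_mx (1 : 'rV[R]_1) (v i) else 0)
          : 'M[R]_(k.+1, 1 + n))).-1.

Definition in_dilate (q : R) (T : {set 'I_k.+1}) (x : 'rV[R]_n) : Prop :=
  exists lam : 'I_k.+1 -> R,
    [/\ forall i, 0 <= lam i,
        forall i, i \notin T -> lam i = 0,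
        \sum_i lam i = 1
      & x = q *: \sum_i lam i *: v i].

(* g-polynomial truncation: from f_Q and k = dim Q,
   g_Q = f_0 + (f_1 - f_0) x + ... + (f_m - f_{m-1}) x^m, m = floor(k/2) *)
Definition trunc_g (kk : nat) (f : {poly int}) : {poly int} :=
  \poly_(l < (kk./2).+1) (f`_l - (if (l == 0)%N then 0 else f`_(l.-1))).

(* gt_fuel _ T = g_{P^dual(F_T)}, computed on the face poset: the faces of
   P^dual(F) are the P^dual(H) for faces H ⊇ F (order reversed),
   dim P^dual(H) = n - 1 - dim H, the empty face being P^dual(P).
   For Q = P^dual(F), k_Q = n-1-dim F, and the proper faces of Q are
   P^dual(H), F ⊊ H ⊆ P, contributing g * (x-1)^(k_Q-1-dim P^dual(H))
   = g * (x-1)^(dim H - dim F - 1). The fuel only guarantees termination. *)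
Fixpoint gt_fuel (fuel : nat) (T : {set 'I_k.+1}) : {poly int} :=
  match fuel with
  | 0 => 1
  | fuel'.+1 =>
      if T == finset.setT then 1 else
      trunc_g (n - 1 - affdim T)
        (\sum_(H : {set 'I_k.+1} | faceb H && (T \proper H))
            gt_fuel fuel' H * ('X - 1) ^+ (affdim H - affdim T - 1))
  end.

Definition gtilde (T : {set 'I_k.+1}) : {poly int} := gt_fuel k.+2 T.

Local Open Scope complex_scope.
Definition phi_eval (phi : {mpoly R[i][n]}) (x : 'rV[R]_n) : R[i] :=
  meval (fun j => (x 0 j)%:C) phi.
Local Close Scope complex_scope.

Definition ehr_sum (B : 'M[R]_n) (phi : {mpoly R[i][n]})
    (T : {set 'I_k.+1}) (q : nat) : R[i] :=
  \sum_(m \in [set m | in_lattice B m /\ in_dilate q%:R T m]) phi_eval phi m.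

Definition Gfun (d : nat) (D : {set 'I_k.+1} -> {poly R[i]}) (q y : R[i])
  : R[i] :=
  (y + 1) ^+ d *
  \sum_(T : {set 'I_k.+1} | faceb T)
     ((y + 1) ^+ (affdim T) * (- y) ^+ (n - affdim T) * (D T).[q]
      * (map_poly (fun a : int => a%:~R) (gtilde T)).[- y^-1]).

End LatticePolytope.

(* Main.v *)
(* Put the points v i at height 1 and study the cones over the faces.

   Weighted Ehrhart reciprocity holds for an arbitrary polynomial weight: a
   regular triangulation by simplicial cones, made half-open by a generic
   interior direction xi, partitions the cone, and the opposite direction
   partitions its relative interior.  For a half-open simplicial cone the signed
   sum over a height slice is polynomial in the height, since its finite
   differences have smaller weight degree or fewer free coordinates.

   Applying reciprocity twice, to a face and to all of its faces, and separating
   lattice points by polynomial weights yields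
     sum_(G <= E <= F) (-1)^(dim E) = 0 for faces G < F,
   so intervals of nonempty faces are Eulerian.  This gives Stanley's identity
     x^(n - dim T) g_T(1/x) = sum_(H >= T) g_H(x) (x - 1)^(dim H - dim T).

   For a positive integer q, write D_F(q) as the sum over E <= F of the sums a_E
   over the relative interiors, and D_F(-q) = (-1)^(dim F + d) a_F; the
   coefficients of each a_E on the two sides agree by Stanley's identity.  Both
   sides are polynomial in q. *)

Require Import Defs.
From mathcomp Require Import all_boot all_order all_algebra.
From mathcomp Require Import boolp classical_sets functions cardinality fsbigop reals.
From mathcomp Require Import zify ring lra.
From mathcomp Require Import complex.
From mathcomp Require Import mpoly.

Set Implicit Arguments.
Unset Strict Implicit.
Unset Printing Implicit Defensive.

Import Order.TTheory GRing.Theory Num.Theory.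
Local Open Scope ring_scope.

(** * Polynomial functions on abelian groups *)

(** Reciprocity is carried by one function on all integers: at s > 0 it sums the weight over the
    slice of the cone at height s, at s < 0 it sums it, up to sign, over the negatives of the points
    of the relative interior at height -s. Proving this single function polynomial replaces
    generating functions, and finite differences treat weights on the lattice and functions of the
    height by the same notion [poldeg].

    Arbitrary weights are kept because they turn identities between weighted sums into identities
    between indicators. Euler's relation is then the value of such an identity at one lattice point
    interior to G, so no topology enters.

    In the final comparison only one side needs Stanley's identity. On the left, the terms (y +
    1)^(dim F) (-y)^(n - dim F) g_F(-1/y) over all F containing E add up to (y + 1)^(dim E) g_E(-y).
    On the right, D_F(-q) is already a single a_F up to sign, and g_F is already taken at -y. *)

Section PolynomialFunctions.
Variables (A : zmodType) (K : comNzRingType).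
Implicit Types f g : A -> K.

(* [poldeg D f]: all D-fold finite differences of f vanish, i.e. f is polynomial
   of degree < D. *)
Fixpoint poldeg (D : nat) f : Prop :=
  if D is D'.+1 then forall a, poldeg D' (fun x => f (x + a) - f x)
  else forall x, f x = 0.

Definition polfun f := exists D, poldeg D f.

Lemma poldeg_eq D f g : f =1 g -> poldeg D f -> poldeg D g.
Proof. by move=> /funext ->. Qed.

Lemma poldegD D f g : poldeg D f -> poldeg D g -> poldeg D (fun x => f x + g x).
Proof.
elim: D f g => [|D IH] f g /= Hf Hg; first by move=> x; rewrite Hf Hg addr0.
move=> a; apply: poldeg_eq (IH _ _ (Hf a) (Hg a)) => x.
by rewrite opprD addrACA.
Qed.

Lemma poldegN D f : poldeg D f -> poldeg D (fun x => - f x).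
Proof.
elim: D f => [|D IH] f /= Hf; first by move=> x; rewrite Hf oppr0.
by move=> a; apply: poldeg_eq (IH _ (Hf a)) => x; rewrite opprD.
Qed.

Lemma poldeg_shift D f b : poldeg D f -> poldeg D (fun x => f (x + b)).
Proof.
elim: D f => [|D IH] f /= Hf; first by move=> x; rewrite Hf.
by move=> a; apply: poldeg_eq (IH _ (Hf a)) => x; rewrite addrAC.
Qed.

Lemma poldegS D f : poldeg D f -> poldeg D.+1 f.
Proof.
elim: D f => [|D IH] f /= Hf; first by move=> a x; rewrite !Hf subr0.
by move=> a; apply: IH.
Qed.

Lemma poldeg_leq D E f : (D <= E)%N -> poldeg D f -> poldeg E f.
Proof.
by move=> /subnK <-; elim: (E - D)%N => [//|m IH] /IH; exact: poldegS.
Qed.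

(** Discrete Leibniz rule: the difference of f g in direction a is (Delta f)(x) g(x + a) + f(x)
    (Delta g)(x), and each summand lowers one of the two bounds. *)
Lemma poldegM D E f g :
  poldeg D f -> poldeg E g -> poldeg (D + E) (fun x => f x * g x).
Proof.
move: {2}(D + E)%N (leqnn (D + E)) => m; elim: m D E f g => [|m IH] D E f g.
  rewrite leqn0 addn_eq0 => /andP[/eqP-> /eqP->] Hf Hg x.
  by rewrite Hf mul0r.
case: D => [|D] DEm Hf Hg.
  by apply: (@poldeg_leq 0%N) => // x; rewrite Hf mul0r.
case: E DEm Hg => [|E] DEm Hg.
  by apply: (@poldeg_leq 0%N) => // x; rewrite Hg mulr0.
move=> a.
have H1 : poldeg (D + E.+1) (fun x => (f (x + a) - f x) * g (x + a)).
  by apply: IH; [rewrite -ltnS| exact: Hf | exact: poldeg_shift].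
have H2 : poldeg (D + E.+1) (fun x => f x * (g (x + a) - g x)).
  by rewrite addnS -addSn; apply: IH; [rewrite -ltnS -addnS| exact: Hf | exact: Hg].
apply: poldeg_eq (poldegD H1 H2) => x.
by rewrite mulrBl mulrBr addrA subrK.
Qed.

Lemma poldeg_cst c : poldeg 1 (fun=> c).
Proof. by move=> a x; rewrite subrr. Qed.

Lemma poldeg_additive f : {morph f : x y / x + y} -> poldeg 2 f.
Proof. by move=> fD a; apply: poldeg_eq (poldeg_cst (f a)) => x; rewrite fD addrC addKr. Qed.

Lemma polfun_eq f g : f =1 g -> polfun f -> polfun g.
Proof. by move=> fg [D Df]; exists D; apply: poldeg_eq Df. Qed.

Lemma polfun_cst c : polfun (fun=> c).
Proof. by exists 1%N; apply: poldeg_cst. Qed.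

Lemma polfunD f g : polfun f -> polfun g -> polfun (fun x => f x + g x).
Proof.
move=> [D Hf] [E Hg]; exists (maxn D E); apply: poldegD.
  exact: poldeg_leq (leq_maxl _ _) Hf.
exact: poldeg_leq (leq_maxr _ _) Hg.
Qed.

Lemma polfunN f : polfun f -> polfun (fun x => - f x).
Proof. by move=> [D Hf]; exists D; apply: poldegN. Qed.

Lemma polfunM f g : polfun f -> polfun g -> polfun (fun x => f x * g x).
Proof. by move=> [D Hf] [E Hg]; exists (D + E)%N; apply: poldegM. Qed.

Lemma polfun_additive f : {morph f : x y / x + y} -> polfun f.
Proof. by move=> fD; exists 2%N; apply: poldeg_additive. Qed.

Lemma polfun_sum (I : Type) (r : seq I) (P : pred I) (F : I -> A -> K) :
  (forall i, P i -> polfun (F i)) -> polfun (fun x => \sum_(i <- r | P i) F i x).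
Proof.
move=> HF; elim: r => [|i r IH].
  by apply: polfun_eq (polfun_cst 0) => x; rewrite big_nil.
case Pi: (P i).
  by apply: polfun_eq (polfunD (HF i Pi) IH) => x; rewrite big_cons Pi.
by apply: polfun_eq IH => x; rewrite big_cons Pi.
Qed.

Lemma polfun_prod (I : Type) (r : seq I) (P : pred I) (F : I -> A -> K) :
  (forall i, P i -> polfun (F i)) -> polfun (fun x => \prod_(i <- r | P i) F i x).
Proof.
move=> HF; elim: r => [|i r IH].
  by apply: polfun_eq (polfun_cst 1) => x; rewrite big_nil.
case Pi: (P i).
  by apply: polfun_eq (polfunM (HF i Pi) IH) => x; rewrite big_cons Pi.
by apply: polfun_eq IH => x; rewrite big_cons Pi.
Qed.

Lemma polfunX f m : polfun f -> polfun (fun x => f x ^+ m).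
Proof.
move=> Hf; elim: m => [|m IH]; first exact: polfun_cst.
by apply: polfun_eq (polfunM Hf IH) => x; rewrite exprS.
Qed.

End PolynomialFunctions.

Lemma polfun_comp (A B : zmodType) (K : comNzRingType) (h : A -> B) (f : B -> K) :
  {morph h : x y / x + y} -> polfun f -> polfun (f \o h).
Proof.
move=> hD [D Hf]; exists D; elim: D f Hf => [|D IH] f /= Hf; first by move=> x /=.
by move=> a; apply: poldeg_eq (IH _ (Hf (h a))) => x /=; rewrite hD.
Qed.

(** * Polynomial functions of one integer variable *)

Section PolynomialFunctionsInt.
Variable K : comNzRingType.
Implicit Types f g : int -> K.

(** A difference with step m telescopes into shifts of the unit difference; a negative step is a
    shifted positive one with the opposite sign. *)
Lemma poldeg_diff1 D f : poldeg D (fun s => f (s + 1) - f s) -> poldeg D.+1 f.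
Proof.
move=> Hf.
have pos (m : nat) : poldeg D (fun s => f (s + m%:Z) - f s).
  elim: m => [|m IH].
    by apply: (@poldeg_leq _ _ 0%N) => // s; rewrite addr0 subrr.
  apply: poldeg_eq (poldegD (poldeg_shift m%:Z Hf) IH) => s.
  by rewrite addrA subrK intS [1 + _]addrC addrA.
move=> [m|m]; first exact: pos.
apply: poldeg_eq (poldegN (poldeg_shift (- m.+1%:Z) (pos m.+1))) => s.
by rewrite subrK opprB NegzE.
Qed.

Lemma polfun_diff1 f : polfun (fun s => f (s + 1) - f s) -> polfun f.
Proof. by move=> [D Hf]; exists D.+1; apply: poldeg_diff1. Qed.

(** Roots cannot be counted over a mere commutative ring. Instead, the unit difference vanishes by
    induction, so f has period 1 and every value equals one at a positive integer. *)
Lemma polfun_eq0 f : polfun f -> (forall m : nat, (0 < m)%N -> f m%:Z = 0) ->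
  forall s, f s = 0.
Proof.
move=> [D]; elim: D f => [|D IH] f Hf f0; first exact: Hf.
have d0 s : f (s + 1) = f s.
  apply/eqP; rewrite -subr_eq0; apply/eqP; apply: (IH (fun s => f (s + 1) - f s)) => // m m0.
  by rewrite [m%:Z + 1]addrC -intS !f0 // subrr.
have pos s (m : nat) : f (s + m%:Z) = f s.
  by elim: m => [|m IHm]; rewrite ?addr0 // intS [1 + _]addrC addrA d0.
move=> s; rewrite -(pos s `|s|%N.+1).
have [m -> m0] : exists2 m : nat, s + `|s|%N.+1%:Z = m%:Z & (0 < m)%N.
  case: s => m; first by exists (m + m.+1)%N; [rewrite absz_nat PoszD|rewrite addnS].
  by exists 1%N => //; rewrite (_ : `|Negz m|%N = m.+1) // NegzE addrC intS addrK.
exact: f0.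
Qed.

Lemma polfun_ext f g : polfun f -> polfun g ->
  (forall m : nat, (0 < m)%N -> f m%:Z = g m%:Z) -> f =1 g.
Proof.
move=> Hf Hg fg s; apply/eqP; rewrite -subr_eq0; apply/eqP.
apply: (@polfun_eq0 (fun s => f s - g s)); first exact: polfunD (polfunN Hg).
by move=> m m0; rewrite fg // subrr.
Qed.

Lemma polfun_horner (p : {poly K}) : polfun (fun s : int => p.[s%:~R]).
Proof.
apply: (@polfun_eq _ _ (fun s : int => \sum_(i < size p) p`_i * s%:~R ^+ i)).
  by move=> s; rewrite horner_coef.
apply: polfun_sum => i _; apply: polfunM; first exact: polfun_cst.
by apply: polfunX; apply: polfun_additive => x y; rewrite intrD.
Qed.

End PolynomialFunctionsInt.

(** * Sums of finitely supported functions *)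

Section FiniteSupportSums.
Variables (Z : choiceType) (K : comNzRingType).
Implicit Types f g : Z -> K.

Definition fsupp f := finite_set [set z | f z != 0].
(** The sum defaults to 0 when infinitely many terms are nonzero, hence the [fsupp] side conditions
    on additivity. *)
Definition fsum f := \sum_(z \in [set: Z]) f z.

Lemma fsum_on (X : set Z) f : (forall z, f z != 0 -> X z) ->
  fsum f = \sum_(z \in X) f z.
Proof.
move=> H; apply/esym/fsbig_widen => // z [_] /= nX.
by apply/eqP/negPn/negP => /H.
Qed.

Lemma fsum_eq f g : f =1 g -> fsum f = fsum g.
Proof. by move=> /funext ->. Qed.

Lemma fsumD f g : fsupp f -> fsupp g -> fsum (fun z => f z + g z) = fsum f + fsum g.
Proof.
move=> Hf Hg; pose X := ([set z | f z != 0] `|` [set z | g z != 0])%classic.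
have fX : finite_set X by rewrite finite_setU.
rewrite !(@fsum_on X) ?fsbig_split // => z h; rewrite /X /=; try by [left|right].
have [f0|] := eqVneq (f z) 0; last by left.
by right; move: h; rewrite f0 add0r.
Qed.

Lemma fsuppD f g : fsupp f -> fsupp g -> fsupp (fun z => f z + g z).
Proof.
move=> Hf Hg; pose X := ([set z | f z != 0] `|` [set z | g z != 0])%classic.
have fX : finite_set X by rewrite finite_setU.
apply: sub_finite_set fX => z /= h; rewrite /X /=.
have [f0|] := eqVneq (f z) 0; last by left.
by right; move: h; rewrite f0 add0r.
Qed.

Lemma fsuppMr f g : fsupp f -> fsupp (fun z => f z * g z).
Proof.
by apply: sub_finite_set => z /=; apply: contra => /eqP->; rewrite mul0r.
Qed.

Lemma fsum0 : fsum (fun=> 0) = 0.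
Proof. by rewrite /fsum fsbig1. Qed.

Lemma fsupp0 : fsupp (fun=> 0).
Proof. by apply: sub_finite_set (@finite_set0 _) => z /=; rewrite eqxx. Qed.

Lemma fsupp_sum (I : Type) (r : seq I) (P : pred I) (F : I -> Z -> K) :
  (forall i, P i -> fsupp (F i)) -> fsupp (fun z => \sum_(i <- r | P i) F i z).
Proof.
move=> HF; elim: r => [|i r IH].
  by rewrite (_ : (fun z => _) = (fun=> 0)); [exact: fsupp0|apply/funext => z; rewrite big_nil].
case Pi: (P i).
  rewrite (_ : (fun z => _) = fun z => F i z + \sum_(i <- r | P i) F i z).
    by apply: fsuppD => //; exact: HF.
  by apply/funext => z; rewrite big_cons Pi.
rewrite (_ : (fun z => _) = fun z => \sum_(i <- r | P i) F i z) //.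
by apply/funext => z; rewrite big_cons Pi.
Qed.

Lemma fsum_sum (I : Type) (r : seq I) (P : pred I) (F : I -> Z -> K) :
  (forall i, P i -> fsupp (F i)) ->
  fsum (fun z => \sum_(i <- r | P i) F i z) = \sum_(i <- r | P i) fsum (F i).
Proof.
move=> HF; elim: r => [|i r IH].
  by rewrite big_nil -[RHS]fsum0; apply: fsum_eq => z; rewrite big_nil.
rewrite big_cons; case Pi: (P i); last first.
  by rewrite -IH; apply: fsum_eq => z; rewrite big_cons Pi.
rewrite -IH -fsumD; [|exact: HF|exact: fsupp_sum].
by apply: fsum_eq => z; rewrite big_cons Pi.
Qed.

Lemma fsum_single z0 f : (forall z, z != z0 -> f z = 0) -> fsum f = f z0.
Proof.
move=> H; rewrite (@fsum_on [set z0]) ?fsbig_set1 // => z /=.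
by apply: contraNeq => /H ->; rewrite eqxx.
Qed.

Lemma fsum_reindex (h : Z -> Z) f : bijective h -> fsum f = fsum (f \o h).
Proof. by move=> hb; rewrite /fsum (reindex_fsbigT h). Qed.

End FiniteSupportSums.

Lemma fsumMl (Z : choiceType) (K : idomainType) c (f : Z -> K) :
  fsum (fun z => c * f z) = c * fsum f.
Proof. by rewrite /fsum mulr_fsumr. Qed.

(** * Height slices of a half-open simplicial cone *)

Section SignedCone.
Variables (Z : zmodType) (K : comNzRingType) (I : finType) (S : {set I}).
Variables (zs : I -> Z) (inspan : int -> Z -> bool) (rcoord : I -> int -> Z -> int).
Hypothesis inspan_shift : forall i (s : int) z, i \in S -> inspan (s + 1) (z + zs i) = inspan s z.
Hypothesis rcoord_shift : forall i j (s : int) z, i \in S -> j \in S -> inspan s z ->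
  rcoord j (s + 1) (z + zs i) = rcoord j s z + (i == j)%:R.

(* The coordinates outside J are frozen in a fundamental cell, those in J are all
   >= 0 (the cone) or all < 0 (minus the complementary half-open cone).  The sign
   is such that the difference in the direction of a generator i in J is the
   function for J :\ i, and the function for the empty J is 0. *)
Definition signed_ind (J : {set I}) s z : K :=
  (inspan s z && [forall i in S :\: J, rcoord i s z == 0])%:R *
  (\prod_(i in J) (0 <= rcoord i s z)%R%:R - \prod_(i in J) - (rcoord i s z < 0)%R%:R).

Hypothesis signed_ind_fin : forall (J : {set I}) s, J \subset S -> fsupp (signed_ind J s).

Lemma signed_ind_diff (J : {set I}) (s : int) z i : J \subset S -> i \in J ->
  signed_ind J (s + 1) (z + zs i) - signed_ind J s z = signed_ind (J :\ i) (s + 1) (z + zs i).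
Proof.
move=> JS iJ; have iS : i \in S := fintype.subsetP JS i iJ.
rewrite /signed_ind inspan_shift //; case inspan_sz: (inspan s z); last by rewrite !mul0r subr0.
rewrite !(big_setD1 i iJ) /=.
have kj j : j \in S -> j != i -> rcoord j (s + 1) (z + zs i) = rcoord j s z.
  by move=> jS ji; rewrite rcoord_shift // eq_sym (negPf ji) addr0.
have -> : [forall j in S :\: J, rcoord j (s + 1) (z + zs i) == 0] =
          [forall j in S :\: J, rcoord j s z == 0].
  apply: eq_forallb => j; rewrite inE; case: (boolP (j \in J)) => //= jJ.
  case: (boolP (j \in S)) => //= jS; rewrite kj //.
  by apply: contraNneq jJ => ->.
have -> : [forall j in S :\: (J :\ i), rcoord j (s + 1) (z + zs i) == 0] =
   [forall j in S :\: J, rcoord j s z == 0] && (rcoord i (s + 1) (z + zs i) == 0).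
  apply/forall_inP/andP => [H|[/forall_inP H H0] j].
    split; last by apply: H; rewrite !inE eqxx iS.
    apply/forall_inP => j; rewrite inE => /andP[jJ jS]; rewrite -kj //.
      by apply: H; rewrite !inE jS negb_and jJ orbT.
    by apply: contraNneq jJ => ->.
  rewrite !inE negb_and negbK => /andP[/orP[/eqP->//|jJ] jS].
  rewrite kj //; first by apply: H; rewrite inE jJ.
  by apply: contraNneq jJ => ->.
case: [forall j in S :\: J, _] => /=; last by rewrite !mul0r subr0.
have E1 : \prod_(j in J :\ i) ((0 <= rcoord j (s + 1) (z + zs i))%R%:R : K) =
          \prod_(j in J :\ i) (0 <= rcoord j s z)%R%:R.
  by apply: eq_bigr => j; rewrite !inE => /andP[ji jJ]; rewrite kj // (fintype.subsetP JS).
have E2 : \prod_(j in J :\ i) (- (rcoord j (s + 1) (z + zs i) < 0)%R%:R : K) =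
          \prod_(j in J :\ i) - (rcoord j s z < 0)%R%:R.
  by apply: eq_bigr => j; rewrite !inE => /andP[ji jJ]; rewrite kj // (fintype.subsetP JS).
rewrite E1 E2 {E1 E2}.
rewrite !(@rcoord_shift i i) // eqxx mulr1n; move: (rcoord i s z) => t.
set P := \prod_(j in _) _; set Q := \prod_(j in _) _.
have -> : (0 <= t + 1)%R = (0 <= t) || (t == -1) by lia.
have -> : (t + 1 < 0)%R = (t < 0) && (t != -1) by lia.
have -> : (t + 1 == 0)%R = (t == -1) by lia.
case: (t =P -1) => [->|]; rewrite ?orbT ?andbF ?orbF ?andbT /=.
  by ring.
by move=> _; ring.
Qed.

(* F_J(s + 1; phi) - F_J(s; phi) = F_(J - i)(s + 1; phi) + F_J(s; Delta_i phi),
   whence a double induction on #|J| and the degree of phi. *)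
Lemma polfun_signed_sum (J : {set I}) phi : J \subset S -> polfun phi ->
  polfun (fun s => fsum (fun z => signed_ind J s z * phi z)).
Proof.
move=> + [D]; move: {2}#|J| (leqnn #|J|) => m.
elim: m J D phi => [|m IHm] J D phi Jm JS.
  move: Jm; rewrite leqn0 cards_eq0 => /eqP-> _.
  apply: polfun_eq (polfun_cst _ 0) => s; rewrite -(@fsum0 Z K).
  by apply: fsum_eq => z; rewrite /signed_ind !big_set0 subrr mulr0 mul0r.
elim: D phi => [|D IHD] phi Hphi.
  apply: polfun_eq (polfun_cst _ 0) => s; rewrite -(@fsum0 Z K).
  by apply: fsum_eq => z; rewrite Hphi mulr0.
have [J0|[i iJ]] := set_0Vmem J.
  by apply: (IHm _ D.+1) => //; rewrite J0 cards0.
apply: polfun_diff1.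
have JiS : J :\ i \subset S by apply: fintype.subset_trans JS; exact: subD1set.
have [E HE] : polfun (fun s => fsum (fun z => signed_ind (J :\ i) s z * phi z)).
  by apply: (IHm _ D.+1) => //; move: Jm; rewrite (cardsD1 i) iJ.
have HE1 : polfun (fun s => fsum (fun z => signed_ind (J :\ i) (s + 1) z * phi z)).
  by exists E; exact: (poldeg_shift 1 HE).
apply: polfun_eq (polfunD HE1 (IHD _ (Hphi (zs i)))) => s.
have shiftb : bijective (fun z : Z => z + zs i).
  by exists (fun z => z - zs i) => z; rewrite ?addrK ?subrK.
rewrite (fsum_reindex _ shiftb) [in RHS](fsum_reindex (fun z => signed_ind J (s + 1) z * _) shiftb).
have sh (X : {set I}) : X \subset S -> fsupp (fun z => signed_ind X (s + 1) (z + zs i)).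
  move=> XS; have := @signed_ind_fin X (s + 1) XS.
  move=> /(finite_image (fun z => z - zs i)); apply: sub_finite_set => z /= h.
  by exists (z + zs i); rewrite ?addrK.
rewrite -fsumD; last 2 first.
- exact: (fsuppMr (fun z => phi (z + zs i)) (sh _ JiS)).
- exact: (fsuppMr _ (signed_ind_fin s JS)).
apply/eqP; rewrite eq_sym subr_eq -fsumD; last 2 first.
- apply: fsuppD; first exact: (fsuppMr (fun z => phi (z + zs i)) (sh _ JiS)).
  exact: (fsuppMr _ (signed_ind_fin s JS)).
- exact: (fsuppMr _ (signed_ind_fin s JS)).
apply/eqP/fsum_eq => z /=; rewrite -(signed_ind_diff s z JS iJ) mulrBl mulrBr.
by rewrite !addrA subrK subrK.
Qed.

End SignedCone.

(** * Generic points *)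

Section Eventually.
Variable R : realFieldType.
Implicit Types (P Q : R -> Prop).

Definition near0 P := exists2 d : R, 0 < d & forall e, 0 < e -> e < d -> P e.

Lemma near0T P : (forall e, 0 < e -> P e) -> near0 P.
Proof. by move=> H; exists 1 => // e e0 _; exact: H. Qed.

Lemma near0_sub P Q : (forall e, 0 < e -> P e -> Q e) -> near0 P -> near0 Q.
Proof. by move=> PQ [d d0 Hd]; exists d => // e e0 ed; apply: PQ => //; apply: Hd. Qed.

Lemma near0_and P Q : near0 P -> near0 Q -> near0 (fun e => P e /\ Q e).
Proof.
move=> [d d0 Hd] [d' d0' Hd']; exists (Num.min d d'); first by rewrite lt_min d0.
by move=> e e0; rewrite lt_min => /andP[ed ed']; split; [apply: Hd|apply: Hd'].
Qed.

Lemma near0_ex P : near0 P -> exists2 e, 0 < e & P e.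
Proof.
move=> [d d0 Hd]; exists (d / 2); first by rewrite divr_gt0.
by apply: Hd; [rewrite divr_gt0 | lra].
Qed.

Lemma near0_all_seq (I : eqType) (s : seq I) (P : I -> R -> Prop) :
  (forall i, i \in s -> near0 (P i)) -> near0 (fun e => forall i, i \in s -> P i e).
Proof.
elim: s => [|i s IH] H; first by apply: near0T.
have H1 : near0 (P i) by apply: H; rewrite inE eqxx.
have H2 : near0 (fun e => forall j, j \in s -> P j e).
  by apply: IH => j js; apply: H; rewrite inE js orbT.
apply: near0_sub (near0_and H1 H2) => e _ [Pi Ps] j; rewrite inE.
by case/orP => [/eqP->|/Ps].
Qed.

Lemma near0_all (I : finType) (P : I -> R -> Prop) :
  (forall i, near0 (P i)) -> near0 (fun e => forall i, P i e).
Proof.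
move=> H; apply: near0_sub (@near0_all_seq I (enum I) P _) => [e _ He i|i _] //.
by apply: He; rewrite mem_enum.
Qed.

Lemma near0_addgt0 (a b : R) : 0 < a \/ (a = 0 /\ 0 < b) -> near0 (fun e => 0 < a + e * b).
Proof.
case=> [a0|[-> b0]]; last by apply: near0T => e e0; rewrite add0r mulr_gt0.
have b1 : 0 < `|b| + 1 by rewrite ltr_wpDl.
exists (a / (`|b| + 1)) => [|e e0]; first by rewrite divr_gt0.
rewrite ltr_pdivlMr // => He.
have : e * - b <= e * `|b| by rewrite ler_pM2l // -normrN ler_norm.
by rewrite mulrN; lra.
Qed.

(** For small e the sign of a + e * b is the lexicographic sign of (a, b). As b is nonzero, the test
    holds for (a, b) or for (-a, -b). *)
Lemma near0_sgn (a b : R) : b != 0 ->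
  near0 (fun e => 0 < a + e * b <-> 0 < a \/ (a = 0 /\ 0 < b)).
Proof.
move=> b0; have [H|H] := pselect (0 < a \/ (a = 0 /\ 0 < b)).
  by apply: near0_sub (near0_addgt0 H).
have H' : 0 < - a \/ (- a = 0 /\ 0 < - b).
  have [a0|a0|a0] := ltgtP a 0.
  - by left; lra.
  - by exfalso; apply: H; left.
  - right; split; first by rewrite a0 oppr0.
    have := b0; rewrite neq_lt => /orP[|b1]; first by lra.
    by exfalso; apply: H; right.
apply: near0_sub (near0_addgt0 H') => e e0; rewrite mulrN => He; split=> //.
by move=> ?; exfalso; lra.
Qed.

(** Two values of e with u + e * v in U would put v, and then u, in U; so at most one e is bad. *)
Lemma near0_notin (p N : nat) (U : 'M[R]_(p, N)) (u v : 'rV[R]_N) :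
  ~~ (u <= U)%MS || ~~ (v <= U)%MS -> near0 (fun e => ~~ ((u + e *: v)%R <= U)%MS).
Proof.
move=> H.
have uniq e e' : ((u + e *: v)%R <= U)%MS -> ((u + e' *: v)%R <= U)%MS -> e = e'.
  move=> He He'; apply/eqP; rewrite -subr_eq0; apply: contraTT H => ne.
  have vU : (v <= U)%MS.
    rewrite -(eqmx_scale v ne).
    rewrite (_ : _ *: v = u + e *: v - (u + e' *: v)); last first.
      by rewrite scalerBl opprD addrACA subrr add0r.
    by apply: addmx_sub; rewrite ?eqmx_opp.
  rewrite vU orbF negbK -(addrK (e *: v) u).
  by apply: addmx_sub; rewrite ?eqmx_opp ?scalemx_sub.
have [[e [e0 He]]|H'] := pselect (exists e, 0 < e /\ ((u + e *: v)%R <= U)%MS).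
  by exists e => // e' e'0 ltee'; apply/negP => /(uniq _ _ He) E; rewrite E ltxx in ltee'.
by apply: near0T => e e0; apply/negP => He; apply: H'; exists e.
Qed.

(** Leave the subspaces one at a time: a small step along a direction outside the next one does not
    re-enter those already avoided. Q is what the steps must preserve, such as lying in a relative
    interior. *)
Lemma avoid_subspaces (p N : nat) (I : Type) (Q : 'rV[R]_N -> Prop) (d : I -> 'rV[R]_N)
    (Us : seq 'M[R]_(p, N)) u0 :
  Q u0 -> (forall u e i, Q u -> 0 < e -> Q (u + e *: d i)) ->
  (forall U, U \in Us -> exists i, ~~ (d i <= U)%MS) ->
  exists2 u, Q u & forall U, U \in Us -> ~~ (u <= U)%MS.
Proof.
move=> Q0 Qd; elim: Us => [|U Us IH] HU; first by exists u0.
have [|u Qu Hu] := IH; first by move=> V VUs; apply: HU; rewrite inE VUs orbT.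
have [|i di] := HU U; first by rewrite inE eqxx.
have H1 : near0 (fun e => ~~ ((u + e *: d i)%R <= U)%MS).
  by apply: near0_notin; rewrite di orbT.
have H2 : near0 (fun e => forall V, V \in Us -> ~~ ((u + e *: d i)%R <= V)%MS).
  by apply: near0_all_seq => V /Hu uV; apply: near0_notin; rewrite uV.
have [e e0 [He1 He2]] := near0_ex (near0_and H1 H2).
exists (u + e *: d i); first exact: Qd.
by move=> V; rewrite inE => /orP[/eqP->|/He2].
Qed.

End Eventually.

(* Locked, since rewriting with [mxE] would unfold the matrix products. *)
Fact coord_mx_key : unit. Proof. exact: tt. Qed.

(** * Cones over finite configurations *)

Section Cones.
Variables (R : realFieldType) (m N : nat) (W : 'M[R]_(m, N)).
Implicit Types (S T : {set 'I_m}) (x : 'rV[R]_N) (l mu : 'rV[R]_m).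

Definition suppd S l := forall i, i \notin S -> l 0 i = 0.
(** A diagonal mask instead of a submatrix lets all S share the types of W and of its coefficient
    vectors. *)
Definition mask_mx S : 'M[R]_m := diag_mx (\row_i (i \in S)%:R).
Definition span_mx S : 'M[R]_(m, N) := mask_mx S *m W.
Definition indep S := \rank (span_mx S) == #|S|.
Definition cone T x :=
  exists l, [/\ forall i, 0 <= l 0 i, suppd T l & x = l *m W].
Definition relint T x :=
  exists l, [/\ forall i, i \in T -> 0 < l 0 i, suppd T l & x = l *m W].
Definition coord_mx S x : 'rV[R]_m := locked_with coord_mx_key (x *m pinvmx (span_mx S) *m mask_mx S).

Lemma mul_mask_mx S l i : (l *m mask_mx S) 0 i = l 0 i * (i \in S)%:R.
Proof. by rewrite mul_mx_diag !mxE. Qed.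

Lemma suppd_mask_mx S l : suppd S l <-> l *m mask_mx S = l.
Proof.
split=> [H|<- i iS]; last by rewrite mul_mask_mx (negPf iS) mulr0.
apply/rowP => i; rewrite mul_mask_mx; case: (boolP (i \in S)) => iS; rewrite ?mulr1 //.
by rewrite H // mul0r.
Qed.

Lemma suppdS S T l : S \subset T -> suppd S l -> suppd T l.
Proof. by move=> ST H i iT; apply: H; apply: contra iT; exact: (fintype.subsetP ST). Qed.

Lemma suppdD S l mu : suppd S l -> suppd S mu -> suppd S (l + mu).
Proof. by move=> H H' i iS; rewrite mxE H // H' // addr0. Qed.

Lemma suppdZ S a l : suppd S l -> suppd S (a *: l).
Proof. by move=> H i iS; rewrite mxE H // mulr0. Qed.

Lemma suppd_delta S j : j \in S -> suppd S (delta_mx 0 j).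
Proof. by move=> jS i iS; rewrite mxE eqxx /=; case: eqP => // E; rewrite -E (negPf iS) in jS *. Qed.

Lemma sub_span_mx S l : suppd S l -> (l *m W <= span_mx S)%MS.
Proof. by move=> /suppd_mask_mx <-; rewrite -mulmxA submxMl. Qed.

Lemma coord_mxK S x : (x <= span_mx S)%MS -> coord_mx S x *m W = x.
Proof. by move=> xS; rewrite /coord_mx !unlock -mulmxA mulmxKpV. Qed.

Lemma suppd_coord_mx S x : suppd S (coord_mx S x).
Proof. by move=> i iS; rewrite /coord_mx unlock mul_mask_mx (negPf iS) mulr0. Qed.

Lemma coord_mxD S x y : coord_mx S (x + y) = coord_mx S x + coord_mx S y.
Proof. by rewrite /coord_mx !unlock !mulmxDl. Qed.

Lemma coord_mxZ S a x : coord_mx S (a *: x) = a *: coord_mx S x.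
Proof. by rewrite /coord_mx !unlock -!scalemxAl. Qed.

Lemma coord_mx_mul S x (c : 'cV_m) : coord_mx S x *m c = x *m (pinvmx (span_mx S) *m (mask_mx S *m c)).
Proof. by rewrite /coord_mx !unlock !mulmxA. Qed.

Lemma rank_mask_mx S : \rank (mask_mx S) = #|S|.
Proof.
pose P : 'M[R]_(#|S|, m) := \matrix_(i, j) (enum_val i == j)%:R.
have PP : P *m P^T = 1%:M.
  apply/matrixP => i j; rewrite !mxE (bigD1 (enum_val i)) //= big1 ?addr0.
    by rewrite !mxE eqxx mul1r (inj_eq enum_val_inj) eq_sym.
  by move=> l li; rewrite !mxE eq_sym (negPf li) mul0r.
have rP : \rank P = #|S|.
  apply/eqP; rewrite eqn_leq rank_leq_row /=.
  by rewrite -{1}(mxrank1 R #|S|) -PP mxrankM_maxl.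
have PM : P *m mask_mx S = P.
  apply/matrixP => i j; rewrite mul_mx_diag !mxE.
  by case: eqP => [<-|]; rewrite ?mul0r // enum_valP mulr1.
have EM : mask_mx S = mask_mx S *m P^T *m P.
  apply/matrixP => i j; rewrite -mulmxA mul_diag_mx !mxE.
  case: (boolP (i \in S)) => iS; last by rewrite mul0r /= mul0rn.
  rewrite mul1r (bigD1 (enum_rank_in iS i)) //= !mxE enum_rankK_in // eqxx mul1r.
  rewrite big1 ?addr0 // => l li; rewrite !mxE; case: eqP => [E|]; last by rewrite mul0r.
  by case/eqP: li; apply: enum_val_inj; rewrite enum_rankK_in // E.
apply/eqP; rewrite eqn_leq; apply/andP; split.
  by rewrite EM (leq_trans (mxrankM_maxr _ _)) // rank_leq_row.
by rewrite -[X in (X <= _)%N]rP -PM mxrankM_maxr.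
Qed.

Lemma rank_span_mx_leq S : (\rank (span_mx S) <= #|S|)%N.
Proof. by rewrite -(rank_mask_mx S) mxrankM_maxl. Qed.

Lemma indep_geq S : (#|S| <= \rank (span_mx S))%N -> indep S.
Proof. by move=> leS; rewrite /indep eqn_leq rank_span_mx_leq. Qed.

Lemma span_mxS S T : S \subset T -> (span_mx S <= span_mx T)%MS.
Proof.
move=> ST; rewrite /span_mx; have -> : mask_mx S = mask_mx S *m mask_mx T.
  apply/matrixP => i j; rewrite mul_mx_diag !mxE.
  case: eqP => [<-|]; last by rewrite !mulr0n mul0r.
  by case: (boolP (i \in S)) => [/(fintype.subsetP ST)->|]; rewrite ?mulr1 // mul0r.
by rewrite -mulmxA submxMl.
Qed.

Lemma indep_inj S l : indep S -> suppd S l -> l *m W = 0 -> l = 0.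
Proof.
move=> /eqP iS sl lW; have := mxrank_mul_ker (mask_mx S) W.
rewrite -/(span_mx S) iS rank_mask_mx -[RHS]addn0 => /eqP; rewrite eqn_add2l mxrank_eq0 => /eqP K0.
apply/eqP; rewrite -submx0 -K0 sub_capmx; apply/andP; split; last by apply/sub_kermxP.
by rewrite -(iffLR (suppd_mask_mx _ _) sl) submxMl.
Qed.

Lemma dep_ex S : ~~ indep S -> exists l, [/\ suppd S l, l *m W = 0 & l != 0].
Proof.
move=> nS; have K0 : (mask_mx S :&: kermx W)%MS != 0.
  apply: contraNneq nS => K0; have := mxrank_mul_ker (mask_mx S) W.
  by rewrite K0 mxrank0 addn0 rank_mask_mx /indep => ->.
have /rowV0Pn[l lK l0] := K0; exists l; split=> //.
  move: lK; rewrite sub_capmx => /andP[/submxP[D ->] _] i iS.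
  by rewrite mul_mask_mx (negPf iS) mulr0.
by move: lK; rewrite sub_capmx => /andP[_ /sub_kermxP].
Qed.

Lemma coord_mx_uniq S l : indep S -> suppd S l -> coord_mx S (l *m W) = l.
Proof.
move=> iS sl; apply/eqP; rewrite -subr_eq0; apply/eqP; apply: (indep_inj iS).
  by move=> i iS'; rewrite !mxE suppd_coord_mx // sl // subr0.
by rewrite mulmxBl coord_mxK ?subrr // sub_span_mx.
Qed.

Lemma relint_cone T x : relint T x -> cone T x.
Proof.
move=> [l [l0 sl ->]]; exists l; split=> // i.
by case: (boolP (i \in T)) => [/l0/ltW|/sl->].
Qed.

Lemma coneS S T x : S \subset T -> cone S x -> cone T x.
Proof. by move=> ST [l [l0 sl ->]]; exists l; split=> //; apply: suppdS sl. Qed.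

Lemma cone_sub T x : cone T x -> (x <= span_mx T)%MS.
Proof. by move=> [l [_ sl ->]]; exact: sub_span_mx. Qed.

Lemma relint_supp S l : (forall i, 0 <= l 0 i) -> suppd S l ->
  exists2 S' : {set 'I_m}, S' \subset S & relint S' (l *m W) /\
    forall i, (i \in S') = (l 0 i != 0).
Proof.
move=> l0 sl; exists [set i | l 0 i != 0].
  by apply/fintype.subsetP => i; rewrite inE; apply: contraNT => /sl ->.
split=> [|i]; last by rewrite inE.
exists l; split=> // i; first by rewrite inE lt_def l0 andbT.
by rewrite inE negbK => /eqP.
Qed.

Lemma ratio_test S l mu : (forall i, i \in S -> 0 < l 0 i) ->
  (exists2 i, i \in S & 0 < mu 0 i) ->
  exists2 i, i \in S & exists t, [/\ 0 < t, 0 < mu 0 i, l 0 i - t * mu 0 i = 0 &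
    forall j, j \in S -> 0 <= l 0 j - t * mu 0 j].
Proof.
move=> l0 [i1 i1S mi1].
case: (@arg_minP _ _ _ i1 (fun i => (i \in S) && (0 < mu 0 i)) (fun i => l 0 i / mu 0 i)).
  by rewrite i1S.
move=> i /andP[iS mi] Hi; exists i => //; exists (l 0 i / mu 0 i); split=> //.
- by rewrite divr_gt0 // l0.
- by rewrite divfK ?subrr // gt_eqF.
move=> j jS; have [mj|mj] := ltP 0 (mu 0 j).
  by rewrite subr_ge0 -ler_pdivlMr //; apply: Hi; rewrite jS.
rewrite subr_ge0 (le_trans _ (ltW (l0 _ jS))) //.
by rewrite mulr_ge0_le0 // divr_ge0 // ltW // l0.
Qed.

Lemma caratheodory S x : relint S x ->
  exists2 S' : {set 'I_m}, S' \subset S & indep S' /\ relint S' x.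
Proof.
move: {2}#|S| (leqnn #|S|) => c; elim: c S => [|c IH] S Sc xS.
  move: Sc; rewrite leqn0 cards_eq0 => /eqP E; rewrite E in xS *.
  exists finset.set0 => //; split=> //; rewrite /indep cards0 -leqn0.
  by have := rank_span_mx_leq finset.set0; rewrite cards0.
have [iS|] := boolP (indep S); first by exists S.
move=> /dep_ex[mu0 [smu0 mu0W mu00]].
have [mu [smu muW mup]] : exists mu, [/\ suppd S mu, mu *m W = 0 &
    exists2 i, i \in S & 0 < mu 0 i].
  have [i mi] : exists i, mu0 0 i != 0.
    apply/existsP; apply: contraNT mu00; rewrite negb_exists => /forallP H.
    by apply/eqP/rowP => i; rewrite mxE; apply/eqP; have := H i; rewrite negbK.
  have iS : i \in S by apply: contraNT mi => /smu0 ->.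
  move: mi; rewrite neq_lt => /orP[mi|mi].
    exists (- mu0); split; first by move=> j jS; rewrite mxE smu0 // oppr0.
      by rewrite mulNmx mu0W oppr0.
    by exists i => //; rewrite mxE oppr_gt0.
  by exists mu0; split=> //; exists i.
have [l [l0 sl xE]] := xS.
have [i iS [t [t0 mi li Hl]]] := ratio_test l0 mup.
have sl' : suppd S (l - t *: mu).
  by apply: suppdD => // j jS; rewrite !mxE smu // mulr0 oppr0.
have Hl' j : 0 <= (l - t *: mu) 0 j.
  case: (boolP (j \in S)) => jS; last by rewrite sl'.
  by rewrite !mxE; exact: Hl.
have [S' S'S [rS' memS']] := relint_supp Hl' sl'.
have [||S'' S''S' H] := IH S'.
- rewrite -ltnS; apply: leq_trans Sc; apply: proper_card; rewrite properE S'S /=.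
  apply/negP => /fintype.subsetP /(_ i iS); rewrite memS' !mxE li.
  by rewrite eqxx.
- by move: rS'; rewrite mulmxBl -scalemxAl muW scaler0 subr0 -xE.
by exists S'' => //; apply: fintype.subset_trans S'S.
Qed.

End Cones.

(** * Half-open regular triangulations *)

Section Triangulation.
Variables (R : realFieldType) (m N : nat) (W : 'M[R]_(m, N)) (h : 'cV[R]_N).
Hypothesis Wh : W *m h = const_mx 1.
Variable T : {set 'I_m}.
Implicit Types (S : {set 'I_m}) (x : 'rV[R]_N) (l mu : 'rV[R]_m).

Local Notation span_mx := (span_mx W).
Local Notation indep := (indep W).
Local Notation cone := (cone W).
Local Notation relint := (relint W).
Local Notation coord_mx := (coord_mx W).

Definition basis S := [&& S \subset T, (span_mx T <= span_mx S)%MS & indep S].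

Definition generic x :=
  (x <= span_mx T)%MS /\ forall S, S \subset T -> (x <= span_mx S)%MS -> (span_mx T <= span_mx S)%MS.

Lemma sum_coord_mx l x : x = l *m W -> \sum_i l 0 i = (x *m h) 0 0.
Proof.
move=> ->; rewrite -mulmxA Wh !mxE; apply: eq_bigr => i _.
by rewrite mxE mulr1.
Qed.

Lemma basis_sub S x : basis S -> (x <= span_mx T)%MS -> (x <= span_mx S)%MS.
Proof. by move=> /and3P[_ TS _] xT; exact: submx_trans TS. Qed.

Lemma generic_basis S x : S \subset T -> indep S -> generic x -> (x <= span_mx S)%MS -> basis S.
Proof. by move=> ST iS [_ gx] xS; rewrite /basis ST iS gx. Qed.

(** A zero coordinate would put x in the span of [S :\ i]; genericity would make that the full span,
    although it has fewer generators than the rank. *)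
Lemma generic_coord_mx S x i : basis S -> generic x -> i \in S -> coord_mx S x 0 i != 0.
Proof.
move=> bS [xT gx] iS; have /and3P[ST TS inS] := bS.
apply/eqP => xi; have xS := basis_sub bS xT.
have SiT : S :\ i \subset T by apply: fintype.subset_trans ST; exact: subD1set.
have xSi : (x <= span_mx (S :\ i))%MS.
  rewrite -(coord_mxK xS); apply: sub_span_mx => j; rewrite !inE negb_and negbK.
  by case/orP => [/eqP->|jS] //; rewrite suppd_coord_mx.
have := leq_trans (mxrankS (span_mxS W ST)) (mxrankS (gx _ SiT xSi)).
move: inS => /eqP ->; move/leq_trans/(_ (rank_span_mx_leq W _)).
by rewrite (cardsD1 i S) iS ltnn.
Qed.

(** Dual nondegeneracy: with the generators lifted to the heights c, no generator of T lies on the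
    hyperplane through a lifted basis that omits it. This makes the induced subdivision
    simplicial. *)
Definition cost_generic (c : 'cV[R]_m) := forall S (y : 'cV[R]_N), basis S ->
  (forall i, i \in S -> (W *m y) i 0 = c i 0) ->
  forall j, j \in T :\: S -> (W *m y) j 0 != c j 0.

(** For given S and j, a bad c satisfies the linear equation that c_j is the combination of the c_i,
    i in S, with the coordinates of w_j. The unit vector at j violates it, because j is not in S. *)
Lemma cost_generic_ex : exists c, cost_generic c.
Proof.
pose k S j : 'cV[R]_m := (delta_mx 0 j - coord_mx S (row j W))^T.
pose Us := [seq kermx (k p.1 p.2) | p <- enum {: {set 'I_m} * 'I_m} &
   basis p.1 && (p.2 \in T :\: p.1)].
have [//|U|c0 _ Hc] := @avoid_subspaces _ _ _ 'I_m (fun=> True) (fun i => delta_mx 0 i) Us 0 I.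
  move=> /mapP[[S j]]; rewrite mem_filter => /andP[/andP[/= bS jTS] _] ->.
  exists j; apply/negP => /sub_kermxP /matrixP /(_ 0 0).
  rewrite -rowE !mxE eqxx /= suppd_coord_mx ?subr0; last by move: jTS; rewrite inE => /andP[].
  by apply/eqP; rewrite eqxx oner_eq0.
exists c0^T => S y bS yS j jTS; have := Hc (kermx (k S j)).
have -> : kermx (k S j) \in Us.
  apply/mapP; exists (S, j) => //; rewrite mem_filter bS jTS /= mem_enum //.
move=> /(_ isT); apply: contra => /eqP yj; apply/sub_kermxP/matrixP => a b.
rewrite !ord1 [RHS]mxE /k linearB /= mulmxBr.
have jT : j \in T by move: jTS; rewrite inE => /andP[].
have wT : (row j W <= span_mx T)%MS.
  by rewrite rowE; apply: sub_span_mx; exact: suppd_delta.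
have wS := basis_sub bS wT.
have E1 : (c0 *m (delta_mx 0 j : 'rV[R]_m)^T) 0 0 = c0 0 j.
  rewrite mxE (bigD1 j) //= !mxE !eqxx mulr1 big1 ?addr0 // => i ij.
  by rewrite !mxE (negPf ij) mulr0.
have E2 : (c0 *m (coord_mx S (row j W))^T) 0 0 = c0 0 j.
  have -> : c0 0 j = (coord_mx S (row j W) *m (W *m y)) 0 0.
    by rewrite mulmxA coord_mxK // -row_mul mxE yj mxE.
  rewrite [LHS]mxE [RHS]mxE; apply: eq_bigr => i _.
  rewrite [_^T _ _]mxE mulrC; have [iS|iS] := boolP (i \in S); last first.
    by rewrite suppd_coord_mx // !mul0r.
  by rewrite yS // mxE.
by rewrite [LHS]mxE [X in _ + X]mxE E1 E2 subrr.
Qed.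

Variable c : 'cV[R]_m.
Hypothesis c_generic : cost_generic c.

(* The cells of the triangulation induced by the heights c: a linear functional
   interpolates c on the cell and lies strictly above c at the other generators. *)
Definition dual_feasible S := exists2 y : 'cV[R]_N,
  (forall i, i \in S -> (W *m y) i 0 = c i 0) &
  (forall j, j \in T :\: S -> c j 0 < (W *m y) j 0).

(** Weak duality with complementary slackness: a representation of x on S2 costs at most the value
    at x of the functional of S1, with equality only if S2 is contained in S1. Both comparisons
    together force both equalities. *)
Lemma dual_uniq S S' x : S \subset T -> S' \subset T ->
  dual_feasible S -> dual_feasible S' -> relint S x -> relint S' x -> S = S'.
Proof.
have le S1 S2 (y1 : 'cV[R]_N) (l2 : 'rV[R]_m) : S1 \subset T -> S2 \subset T ->
    (forall i, i \in S1 -> (W *m y1) i 0 = c i 0) ->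
    (forall j, j \in T :\: S1 -> c j 0 < (W *m y1) j 0) ->
    suppd S2 l2 -> (forall i, i \in S2 -> 0 < l2 0 i) ->
    (l2 *m c) 0 0 <= (l2 *m W *m y1) 0 0 ?= iff (S2 \subset S1).
  move=> S1T S2T y1S y1T s2 l20; rewrite -mulmxA ![(l2 *m _) 0 0]mxE.
  have Eb (F : 'cV_m) : \sum_j l2 0 j * F j 0 = \sum_(j in S2) l2 0 j * F j 0.
    rewrite [LHS](bigID (fun j => j \in S2)) /= [X in _ + X]big1 ?addr0 // => i iS.
    by rewrite s2 // mul0r.
  rewrite (Eb c) (Eb (W *m y1)).
  rewrite (_ : (S2 \subset S1) = [forall (j | j \in S2), j \in S1]); last first.
    by apply/fintype.subsetP/forall_inP.
  apply: leif_sum => j jS2; have [jS1|jS1] := boolP (j \in S1).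
    by rewrite y1S //; apply/leif_refl.
  have jT : c j 0 < (W *m y1) j 0 by apply: y1T; rewrite inE jS1 (fintype.subsetP S2T).
  split; first by rewrite ler_pM2l ?l20 // ltW.
  by apply/negbTE; rewrite lt_eqF // ltr_pM2l // l20.
move=> ST ST' [y yS yT] [y' yS' yT'] [l [l0 sl xl]] [l' [l0' sl' xl']].
have A1 := le _ _ _ _ ST ST' yS yT sl' l0'.
have A2 := le _ _ _ _ ST ST yS yT sl l0.
have B1 := le _ _ _ _ ST' ST yS' yT' sl l0.
have B2 := le _ _ _ _ ST' ST' yS' yT' sl' l0'.
have {}A2 : (l *m c) 0 0 = (x *m y) 0 0 by apply/eqP; rewrite xl A2 subxx.
have {}B2 : (l' *m c) 0 0 = (x *m y') 0 0 by apply/eqP; rewrite xl' B2 subxx.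
move: A1 B1; rewrite -xl -xl' -A2 -B2 => A1 B1.
have E : (l *m c) 0 0 = (l' *m c) 0 0 by apply: le_anti; rewrite A1 B1.
apply/eqP; rewrite finset.eqEsubset; apply/andP; split.
  by rewrite -B1 E.
by rewrite -A1 E.
Qed.

(* A basis of maximal cost is dual feasible: otherwise a pivot of the simplex
   method would increase the cost. *)
Lemma dual_ex x : generic x -> cone T x ->
  exists S, [/\ basis S, dual_feasible S & relint S x].
Proof.
move=> gx cx; have [xT _] := gx.
pose B S := basis S && `[< relint S x >].
have mkB S : indep S -> S \subset T -> relint S x -> B S.
  move=> iS ST rS; rewrite /B; apply/andP; split; last exact/asboolP.
  by apply: (generic_basis ST iS gx); apply: cone_sub; exact: relint_cone.
have [S0 BS0] : exists S, B S.
  have [l [l0 sl xE]] := cx; have [S1 S1T [rS1 _]] := relint_supp W l0 sl.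
  have [S S1S [iS rS]] := caratheodory rS1.
  exists S; apply: mkB => //; first exact: fintype.subset_trans S1T.
  by rewrite xE.
case: (@arg_maxP _ _ _ S0 B (fun S => (coord_mx S x *m c) 0 0) BS0) => S.
move=> /andP[bS /asboolP rS] maxS; exists S; split=> //.
have /and3P[ST TS iS] := bS.
pose y : 'cV[R]_N := pinvmx (span_mx S) *m (mask_mx R S *m c).
have yE j : (W *m y) j 0 = (coord_mx S (row j W) *m c) 0 0.
  by rewrite coord_mx_mul -row_mul [RHS]mxE.
exists y => j => [jS|].
  rewrite yE rowE coord_mx_uniq //; last exact: suppd_delta.
  by rewrite -rowE mxE.
move=> jTS; have := c_generic bS (y := y).
have yS i : i \in S -> (W *m y) i 0 = c i 0.
  move=> iS'; rewrite yE rowE coord_mx_uniq //; last exact: suppd_delta.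
  by rewrite -rowE mxE.
move=> /(_ yS j jTS); rewrite neq_lt => /orP[yj|//]; exfalso.
move: jTS; rewrite inE => /andP[jS jT].
have wjT : (row j W <= span_mx T)%MS by rewrite rowE; apply: sub_span_mx; exact: suppd_delta.
have wjS := basis_sub bS wjT.
pose a := coord_mx S (row j W).
have aW : a *m W = row j W by rewrite coord_mxK.
(* All generators have height 1, so the coordinates of w_j sum to 1 and one of them is positive: the
   pivot cannot be unbounded. *)
have asum : \sum_i a 0 i = 1.
  by rewrite (sum_coord_mx (esym aW)) -row_mul Wh !mxE.
have apos : exists2 i, i \in S & 0 < a 0 i.
  case: (boolP [exists i in S, 0 < a 0 i]) => [/exists_inP//|].
  rewrite negb_exists_in => /forall_inP H.
  suff : \sum_i a 0 i <= 0 by rewrite asum ler10.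
  apply: sumr_le0 => i _.
  have [iS'|iS'] := boolP (i \in S); last by rewrite suppd_coord_mx.
  by rewrite leNgt H.
have [l [l0 sl xE]] := rS.
have [i1 i1S [t [t0 ai1 li1 Hl]]] := ratio_test l0 apos.
(* The pivot: j enters with coefficient t and i1 drops to 0. The cost grows by t times the gap
   between c_j and the functional at w_j. *)
pose mu := l - t *: a + t *: delta_mx 0 j.
have muW : mu *m W = x.
  by rewrite mulmxDl mulmxBl -!scalemxAl aW -rowE subrK.
have muE i : mu 0 i = l 0 i - t * a 0 i + t * (i == j)%:R by rewrite !mxE ?eqxx.
have mu0 i : 0 <= mu 0 i.
  rewrite muE addr_ge0 //; last by rewrite mulr_ge0 ?ler0n // ltW.
  have [iS'|iS'] := boolP (i \in S); first exact: Hl.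
  by rewrite sl // suppd_coord_mx // mulr0 subrr.
have ij1 : i1 != j by apply: contraTneq i1S => ->.
have smu : suppd (j |: S :\ i1) mu.
  move=> i; rewrite !inE negb_or negb_and negbK => /andP[ij /orP[/eqP->|iS']].
    by rewrite muE (negPf ij1) mulr0 addr0.
  by rewrite muE (negPf ij) mulr0 sl // suppd_coord_mx // mulr0 subrr addr0.
have [S' S'S [rS' memS']] := relint_supp W mu0 smu.
rewrite muW in rS'.
have S'T : S' \subset T.
  apply: fintype.subset_trans S'S _; rewrite finset.subUset finset.sub1set jT /=.
  by apply: fintype.subset_trans ST; exact: subD1set.
have cardS' : (#|S'| <= #|S|)%N.
  apply: leq_trans (subset_leq_card S'S) _.
  by rewrite cardsU1 !inE negb_and jS orbT (cardsD1 i1 S) i1S.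
(* Since x is generic, the support S' of [mu] spans; it has no more elements than the basis S, so it
   is again a basis. *)
have spS' : (span_mx T <= span_mx S')%MS.
  by apply: gx.2 => //; apply: cone_sub; exact: relint_cone.
have iS' : indep S'.
  apply: indep_geq; rewrite (leq_trans cardS') // -(eqP iS).
  by rewrite (leq_trans (mxrankS (span_mxS W ST))) // mxrankS.
have E' : coord_mx S' x = mu.
  by rewrite -muW coord_mx_uniq // => i; rewrite memS' negbK => /eqP.
have E : coord_mx S x = l by rewrite xE coord_mx_uniq.
have /= := maxS S' (mkB S' iS' S'T rS').
rewrite E E' leNgt => /negP; apply.
have -> : (mu *m c) 0 0 = (l *m c) 0 0 - t * (a *m c) 0 0 + t * c j 0.
  by rewrite mulmxDl mulmxBl -!scalemxAl -rowE !mxE.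
rewrite -yE.
by rewrite -addrA ltrDl addrC subr_gt0 ltr_pM2l.
Qed.

(* x + e * eta lies in the open simplicial cone over S for all small e > 0. *)
Definition halfopen S (eta x : 'rV[R]_N) := (x <= span_mx T)%MS /\
  forall i, i \in S ->
    0 < coord_mx S x 0 i \/ (coord_mx S x 0 i = 0 /\ 0 < coord_mx S eta 0 i).

Lemma halfopen_near0 S eta x : basis S -> generic eta -> (x <= span_mx T)%MS ->
  near0 (fun e => halfopen S eta x <-> relint S (x + e *: eta)).
Proof.
move=> bS geta xT; have [etaT _] := geta; have /and3P[ST TS iS] := bS.
have [xS etaS] := (basis_sub bS xT, basis_sub bS etaT).
have H i : near0 (fun e => i \in S -> (0 < coord_mx S x 0 i + e * coord_mx S eta 0 i <->
   0 < coord_mx S x 0 i \/ (coord_mx S x 0 i = 0 /\ 0 < coord_mx S eta 0 i))).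
  have [iS'|iS'] := boolP (i \in S); last by apply: near0T.
  by apply: near0_sub (near0_sgn (coord_mx S x 0 i) (generic_coord_mx bS geta iS')) => e e0 He _.
apply: near0_sub (near0_all H) => e e0 {}H; split.
  move=> [_ Hx]; exists (coord_mx S x + e *: coord_mx S eta); split.
  - by move=> i iS'; rewrite mxE [X in _ + X]mxE H //; exact: Hx.
  - by apply: suppdD; [|apply: suppdZ]; exact: suppd_coord_mx.
  - by rewrite mulmxDl -scalemxAl !coord_mxK.
move=> [l [l0 sl xl]]; split=> // i iS'; rewrite -H //.
have -> : coord_mx S x 0 i + e * coord_mx S eta 0 i = (coord_mx S x + e *: coord_mx S eta) 0 i.
  by rewrite !mxE.
by rewrite -coord_mxZ -coord_mxD xl coord_mx_uniq //; exact: l0.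
Qed.

Lemma generic_near0 eta x : generic eta -> (x <= span_mx T)%MS ->
  near0 (fun e => generic (x + e *: eta)).
Proof.
move=> [etaT geta] xT.
have H S : near0 (fun e => S \subset T -> ((x + e *: eta)%R <= span_mx S)%MS -> (span_mx T <= span_mx S)%MS).
  have [ST|ST] := boolP (S \subset T); last by apply: near0T.
  have [TS|TS] := boolP (span_mx T <= span_mx S)%MS; first by apply: near0T.
  have nS : ~~ (eta <= span_mx S)%MS by apply: contra TS; exact: geta.
  apply: near0_sub (@near0_notin _ _ _ (span_mx S) x eta _); last by rewrite nS orbT.
  by move=> e e0 /negPf ->.
apply: near0_sub (near0_all H) => e e0 He; split=> //.
by apply: addmx_sub => //; exact: scalemx_sub.
Qed.

(** For a common small e both half-open conditions at x become open ones at x + e * eta, where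
    [dual_uniq] applies. *)
Lemma halfopen_uniq S S' eta x : generic eta -> basis S -> basis S' ->
  dual_feasible S -> dual_feasible S' ->
  halfopen S eta x -> halfopen S' eta x -> S = S'.
Proof.
move=> geta bS bS' dS dS' hS hS'; have xT := hS.1.
have [e e0 [H H']] := near0_ex (near0_and (halfopen_near0 bS geta xT) (halfopen_near0 bS' geta xT)).
have /and3P[ST _ _] := bS; have /and3P[ST' _ _] := bS'.
exact: dual_uniq ST ST' dS dS' (iffLR H hS) (iffLR H' hS').
Qed.

Lemma halfopen_ex eta x : generic eta -> (x <= span_mx T)%MS ->
  near0 (fun e => cone T (x + e *: eta)) ->
  exists S, [/\ basis S, dual_feasible S & halfopen S eta x].
Proof.
move=> geta xT cx.
have H S : near0 (fun e => basis S -> (halfopen S eta x <-> relint S (x + e *: eta))).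
  have [bS|bS] := boolP (basis S); last by apply: near0T.
  by apply: near0_sub (halfopen_near0 bS geta xT) => e e0 He _.
have [e e0 [[gx {}cx] {}H]] := near0_ex (near0_and (near0_and (generic_near0 geta xT) cx) (near0_all H)).
have [S [bS dS rS]] := dual_ex gx cx.
by exists S; split=> //; apply/H.
Qed.

Variable xi : 'rV[R]_N.
Hypothesis xi_relint : relint T xi.
Hypothesis xi_generic : generic xi.

Lemma generic_opp : generic (- xi).
Proof.
have [xT gx] := xi_generic; split; first by rewrite eqmx_opp.
by move=> S ST; rewrite eqmx_opp; exact: gx.
Qed.

Definition cells : {set {set 'I_m}} := [set S | basis S && `[< dual_feasible S >]].

Lemma cellsP S : S \in cells -> basis S /\ dual_feasible S.
Proof. by rewrite inE => /andP[bS /asboolP]. Qed.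

Lemma card_halfopen eta x (P : Prop) : generic eta ->
  (P <-> exists2 S, S \in cells & halfopen S eta x) ->
  (\sum_(S in cells) `[< halfopen S eta x >] = `[< P >])%N.
Proof.
move=> geta PE; case: (asboolP P) => [/PE[S Sc hS]|nP].
  rewrite (bigD1 S) //=; have -> : `[< halfopen S eta x >] by apply/asboolP.
  rewrite big1 // => S' /andP[Sc' S'S]; case: asboolP => // hS'.
  case/eqP: S'S; have [[bS dS] [bS' dS']] := (cellsP Sc, cellsP Sc').
  exact: halfopen_uniq geta bS' bS dS' dS hS' hS.
by rewrite big1 // => S Sc; case: asboolP => // hS; case: nP; apply/PE; exists S.
Qed.

Lemma cone_cells x :
  (\sum_(S in cells) `[< halfopen S xi x >] = `[< cone T x >])%N.
Proof.
apply: card_halfopen => //; split=> [cx|[S /cellsP[bS dS] [xT hS]]].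
  have xT := cone_sub cx.
  have [|S [bS dS hS]] := halfopen_ex xi_generic xT.
    apply: near0T => e e0; have [l [l0 sl ->]] := cx; have [z [z0 sz ->]] := xi_relint.
    exists (l + e *: z); split.
    - move=> i; rewrite !mxE addr_ge0 // mulr_ge0 //; first exact: ltW.
      by have [/z0/ltW|/sz->] := boolP (i \in T).
    - by apply: suppdD => //; exact: suppdZ.
    - by rewrite mulmxDl -scalemxAl.
  by exists S => //; rewrite inE bS; apply/asboolP.
have /and3P[ST _ _] := bS; apply: (coneS ST).
exists (coord_mx S x); split; [|exact: suppd_coord_mx|by rewrite coord_mxK // basis_sub].
move=> i; have [/hS[/ltW|[->]]|] := boolP (i \in S) => //.
by move=> /(suppd_coord_mx W x) ->.
Qed.

(** The point x - e * xi stays in the cone for small e > 0 exactly when x is in the relative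
    interior: conversely, adding e * xi back makes every coefficient on T positive. *)
Lemma relint_cells x :
  (\sum_(S in cells) `[< halfopen S (- xi) x >] = `[< relint T x >])%N.
Proof.
apply: card_halfopen generic_opp _; split=> [cx|[S /cellsP[bS dS] hS]].
  have xT := cone_sub (relint_cone cx).
  have [|S [bS dS hS]] := halfopen_ex generic_opp xT.
    have [l [l0 sl ->]] := cx; have [z [z0 sz ->]] := xi_relint.
    have H i : near0 (fun e => i \in T -> 0 < l 0 i + e * - z 0 i).
      have [iT|iT] := boolP (i \in T); last by apply: near0T.
      by apply: near0_sub (@near0_addgt0 _ _ (- z 0 i) (or_introl (l0 i iT))) => e e0 He _; exact: He.
    apply: near0_sub (near0_all H) => e e0 He; exists (l - e *: z); split.
    - move=> i; rewrite !mxE -mulrN; have [/He/ltW//|iT] := boolP (i \in T).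
      by rewrite sl // sz // oppr0 mulr0 addr0.
    - by apply: suppdD => //; rewrite -scaleNr; exact: suppdZ.
    - by rewrite mulmxBl -scalemxAl scalerN.
  by exists S => //; rewrite inE bS; apply/asboolP.
have [e e0 He] := near0_ex (halfopen_near0 bS generic_opp hS.1).
have /and3P[ST _ _] := bS.
have [l [l0 sl xl]] := coneS ST (relint_cone (iffLR He hS)).
have [z [z0 sz xz]] := xi_relint; exists (l + e *: z); split.
- by move=> i iT; rewrite !mxE ltr_wpDl // mulr_gt0 // z0.
- by apply: suppdD => //; exact: suppdZ.
- by rewrite mulmxDl -xl -scalemxAl -xz scalerN subrK.
Qed.

End Triangulation.

Lemma generic_relint_ex (R : realFieldType) m N (W : 'M[R]_(m, N)) (T : {set 'I_m}) :
  exists2 xi, relint W T xi & generic W T xi.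
Proof.
pose Us := [seq span_mx W X | X : {set 'I_m} <- enum {: {set 'I_m}} &
   (X \subset T) && ~~ (span_mx W T <= span_mx W X)%MS].
(* Rows outside T are replaced by the zero direction, which preserves [relint]; those in T span
   [span_mx W T], so a subspace containing all of them contains that span. *)
have [|||xi rxi Hxi] := @avoid_subspaces R m N 'I_m (relint W T)
   (fun i => (i \in T)%:R *: row i W) Us (\row_i (i \in T)%:R *m W).
- exists (\row_i (i \in T)%:R); split=> // i iT; first by rewrite mxE iT.
  by rewrite mxE (negPf iT).
- move=> u e i [l [l0 sl ->]] e0; case: (boolP (i \in T)) => iT; last first.
    by rewrite scale0r scaler0 addr0; exists l.
  exists (l + e *: delta_mx 0 i); split.
  + move=> j jT; rewrite !mxE ltr_wpDr ?l0 // mulr_ge0 ?ler0n // ltW //.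
  + by apply: suppdD => //; apply: suppdZ; exact: suppd_delta.
  + by rewrite scale1r mulmxDl -scalemxAl -rowE.
- move=> U /mapP[S]; rewrite mem_filter => /andP[/andP[ST nTS] _] ->.
  apply/existsP; apply: contraR nTS; rewrite negb_exists => /forallP H.
  apply/row_subP => i; have := H i; rewrite negbK /span_mx row_mul.
  have -> : row i (mask_mx R T) = (i \in T)%:R *: delta_mx 0 i.
    apply/rowP => j; rewrite !mxE eqxx /= [j == i]eq_sym.
    by case: eqP; rewrite ?mulr1 ?mulr0.
  by rewrite -scalemxAl -rowE.
exists xi => //; split; first by apply: cone_sub; exact: relint_cone.
move=> S ST; apply: contraTT => nTS; apply: Hxi; apply/mapP; exists S => //.
by rewrite mem_filter ST nTS mem_enum.
Qed.

(** * Farkas' lemma and faces *)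

Section Farkas.
Variables (R : realFieldType) (N : nat).
Implicit Types (s : seq 'rV[R]_N) (b w x : 'rV[R]_N) (y : 'cV[R]_N).

Fixpoint conic s b : Prop :=
  if s is w :: s' then exists2 t : R, 0 <= t & conic s' (b - t *: w) else b = 0.

(** Brings a conic combination of projected generators back to the original ones: the multiples of
    w0 that they carry are nonnegative and collect into a single one. *)
Lemma conic_map (f : 'rV[R]_N -> 'rV[R]_N) w0 s b :
  (forall w, w \in s -> exists2 t : R, 0 <= t & f w = w + t *: w0) ->
  conic [seq f w | w <- s] b -> exists2 t : R, 0 <= t & conic s (b - t *: w0).
Proof.
elim: s b => [|w s IH] b Hf /=; first by move=> ->; exists 0; rewrite ?scale0r ?subr0.
move=> [t t0 /IH[|t' t0' Hc]].
  by move=> w' w's; apply: Hf; rewrite inE w's orbT.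
have [u u0 fw] := Hf w (mem_head _ _).
exists (t * u + t'); first by rewrite addr_ge0 // mulr_ge0.
exists t => //; move: Hc; rewrite fw; congr (conic _ _).
by apply/rowP => j; rewrite !mxE; ring.
Qed.

(* If the functional y found for the tail is negative on the head w0, project
   along w0 onto the kernel of y and recurse. *)
Lemma farkas s b : conic s b \/
  exists2 y : 'cV[R]_N, (forall w, w \in s -> 0 <= (w *m y) 0 0) & (b *m y) 0 0 < 0.
Proof.
move: {2}(size s) (erefl (size s)) => c; elim: c s b => [|c IH] [|w0 s] b //=.
  move=> _; have [->|b0] := eqVneq b 0; [by left|right].
  exists (- b^T) => //; rewrite mulmxN !mxE oppr_lt0.
  have [j bj] : exists j, b 0 j != 0.
    apply/existsP; apply: contraNT b0; rewrite negb_exists => /forallP H.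
    by apply/eqP/rowP => j; rewrite mxE; apply/eqP; have := H j; rewrite negbK.
  rewrite (bigD1 j) //= ltr_pwDl ?sumr_ge0 // => [|i _].
    by rewrite mxE -expr2 lt_def sqrf_eq0 bj sqr_ge0.
  by rewrite mxE -expr2 sqr_ge0.
move=> [sc]; have [Hc|[y ys yb]] := IH s b sc.
  by left; exists 0 => //; rewrite scale0r subr0.
have [yw0|yw0] := leP 0 ((w0 *m y) 0 0).
  by right; exists y => // w; rewrite inE => /orP[/eqP->|/ys].
set d := (w0 *m y) 0 0 in yw0.
pose f w := w - ((w *m y) 0 0 / d) *: w0.
have fy w y' : (f w *m y') 0 0 = (w *m (y' - ((w0 *m y') 0 0 / d) *: y)) 0 0.
  have E (p q : 'M[R]_1) a : (p - a *: q) 0 0 = p 0 0 - a * q 0 0 by rewrite !mxE.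
  by rewrite /f mulmxBl mulmxBr -scalemxAl -scalemxAr !E mulrAC [in RHS]mulrAC [X in _ = _ - X / _]mulrC.
have [||[y' ys' yb']] := IH [seq f w | w <- s] (f b); first by rewrite size_map.
  move=> /(@conic_map _ w0)[|t t0 Hc].
    move=> w ws; exists (- ((w *m y) 0 0 / d)); last by rewrite scaleNr.
    by rewrite oppr_ge0 mulr_ge0_le0 ?ys // invr_le0 ltW.
  (* b is its projection plus (b y / d) w0, and this coefficient is positive because b y and d are
     both negative. *)
  left; exists ((b *m y) 0 0 / d + t).
    by rewrite addr_ge0 // ltW // nmulr_rgt0 // invr_lt0.
  by move: Hc; rewrite /f scalerDl opprD addrA.
right; exists (y' - ((w0 *m y') 0 0 / d) *: y); last by rewrite -fy.
move=> w; rewrite inE => /orP[/eqP->|ws]; rewrite -fy.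
  by rewrite /f divff ?lt_eqF // scale1r subrr mul0mx mxE.
by apply: ys'; apply: map_f.
Qed.

End Farkas.

Section Faces.
Variables (R : realFieldType) (m N : nat) (W : 'M[R]_(m, N)) (h : 'cV[R]_N).
Hypothesis Wh : W *m h = const_mx 1.
Implicit Types (S T E F : {set 'I_m}) (x : 'rV[R]_N) (l mu : 'rV[R]_m).

(* The empty set is a [conic_face], unlike in [is_face]. *)
Definition conic_face T := exists y : 'cV[R]_N,
  forall i, 0 <= (W *m y) i 0 /\ ((W *m y) i 0 == 0) = (i \in T).

Lemma conic_rows T (s : seq 'I_m) b : {subset s <= T} ->
  conic [seq row i W | i <- s] b ->
  exists l, [/\ forall i, 0 <= l 0 i, suppd T l & b = l *m W].
Proof.
elim: s b => [|i s IH] b sT /=.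
  by move=> ->; exists 0; split=> [j|j _|]; rewrite ?mul0mx ?mxE.
move=> [t t0 /IH[|l [l0 sl E]]]; first by move=> j js; apply: sT; rewrite inE js orbT.
exists (l + t *: delta_mx 0 i); split.
- by move=> j; rewrite !mxE addr_ge0 // mulr_ge0 // ler0n.
- by apply: suppdD => //; apply: suppdZ; apply: suppd_delta; apply: sT; rewrite inE eqxx.
- by rewrite mulmxDl -E -scalemxAl -rowE subrK.
Qed.

Lemma mul_dotE l (y : 'cV[R]_N) : (l *m W *m y) 0 0 = \sum_i l 0 i * (W *m y) i 0.
Proof. by rewrite -mulmxA mxE. Qed.

Lemma mul_dot_supp T l (y : 'cV[R]_N) : suppd T l ->
  (l *m W *m y) 0 0 = \sum_(i in T) l 0 i * (W *m y) i 0.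
Proof.
move=> sl; rewrite mul_dotE (bigID (fun i => i \in T)) /= [X in _ + X]big1 ?addr0 //.
by move=> i iT; rewrite sl // mul0r.
Qed.

Lemma cone_height T x : cone W T x -> 0 <= (x *m h) 0 0.
Proof.
move=> [l [l0 _ ->]]; rewrite mul_dotE Wh sumr_ge0 // => i _.
by rewrite mxE mulr1.
Qed.

(* Farkas' lemma for the vector - w_i and the generators - x and w_j, j in T. *)
Lemma positive_coord T x i : cone W T x -> i \in T ->
  (exists l, [/\ forall j, 0 <= l 0 j, suppd T l, x = l *m W & 0 < l 0 i]) \/
  (exists y : 'cV[R]_N, [/\ forall j, j \in T -> 0 <= (W *m y) j 0,
     0 < (W *m y) i 0 & (x *m y) 0 0 <= 0]).
Proof.
move=> cx iT; have [[t t0]|[y yw yi]] := farkas (- x :: [seq row j W | j <- enum T]) (- row i W).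
  move=> /(@conic_rows T)[|l [l0 sl E]]; first by move=> j; rewrite mem_enum.
  left; have {}E : t *: x = (l + delta_mx 0 i) *m W.
    by rewrite mulmxDl -rowE -E scalerN opprK addrAC addNr add0r.
  (* Taking heights shows that t times the height of x is at least 1, so t is positive and can be
     divided out. *)
  have tx : (t * (x *m h) 0 0) = \sum_j l 0 j + 1.
    have : (t *: x *m h) 0 0 = ((l + delta_mx 0 i) *m W *m h) 0 0 by rewrite E.
    rewrite -scalemxAl mxE => ->; rewrite mulmxDl mulmxDl mxE; congr (_ + _).
      by rewrite mul_dotE Wh; apply: eq_bigr => j _; rewrite mxE mulr1.
    by rewrite -rowE -row_mul Wh !mxE.
  have tgt : 0 < t.
    rewrite lt_def t0 andbT; apply: contra_eq_neq tx => ->.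
    by rewrite mul0r eq_sym gt_eqF // ltr_wpDl // sumr_ge0.
  exists (t^-1 *: (l + delta_mx 0 i)); split.
  - by move=> j; rewrite !mxE mulr_ge0 ?invr_ge0 // addr_ge0 // ler0n.
  - by apply: suppdZ; apply: suppdD => //; exact: suppd_delta.
  - by rewrite -scalemxAl -E scalerA mulVf ?scale1r // gt_eqF.
  - by rewrite !mxE !eqxx mulr_gt0 ?invr_gt0 // ltr_wpDl.
right; exists y; split.
- move=> j jT; have wj : row j W \in [seq row i W | i <- enum T].
    by apply: (map_f (fun i => row i W)); rewrite mem_enum.
  by have := yw (row j W); rewrite inE wj orbT -row_mul mxE; apply.
- by move: yi; rewrite mulNmx -row_mul !mxE oppr_lt0.
- by have := yw _ (mem_head _ _); rewrite mulNmx mxE oppr_ge0.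
Qed.

(** Either each generator of T has a positive coefficient in some representation of x, and averaging
    representations makes all of them positive at once; or [positive_coord] gives a functional whose
    zero set in T is a smaller face containing x. *)
Lemma face_cut T x : conic_face T -> cone W T x -> 0 < (x *m h) 0 0 ->
  relint W T x \/ exists2 T' : {set 'I_m}, T' \proper T & conic_face T' /\ cone W T' x.
Proof.
move=> [yT HT] cx x0.
have [[i [iT [y [yT0 yi xy]]]]|H] := pselect (exists i, i \in T /\
   (exists y : 'cV[R]_N, [/\ forall j, j \in T -> 0 <= (W *m y) j 0,
     0 < (W *m y) i 0 & (x *m y) 0 0 <= 0])).
  right; exists [set j in T | (W *m y) j 0 == 0].
    apply/properP; split; first by apply/fintype.subsetP => j; rewrite inE => /andP[].
    by exists i => //; rewrite inE iT gt_eqF.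
  split.
    (* y is controlled on T only. A small multiple of it, added to the functional [yT] exposing T,
       keeps the values off T positive. *)
    have He j : near0 (fun e => j \notin T -> 0 < (W *m yT) j 0 + e * (W *m y) j 0).
      have [jT|jT] := boolP (j \in T); first by apply: near0T.
      have yTj : 0 < (W *m yT) j 0.
        by rewrite lt_def; have [-> ->] := HT j; rewrite jT.
      by apply: near0_sub (@near0_addgt0 _ _ ((W *m y) j 0) (or_introl yTj)) => e e0 He _.
    have [e e0 {}He] := near0_ex (near0_all He).
    exists (yT + e *: y) => j; rewrite mulmxDr -scalemxAr.
    have -> : (W *m yT + e *: (W *m y)) j 0 = (W *m yT) j 0 + e * (W *m y) j 0.
      by rewrite mxE [X in _ + X]mxE.
    rewrite inE; have [jT|jT] := boolP (j \in T); last first.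
      by have := He j jT => /[dup] /gt_eqF -> /ltW.
    have /eqP -> : (W *m yT) j 0 == 0 by rewrite (HT j).2.
    rewrite add0r mulf_eq0 gt_eqF //=; split=> //.
    by rewrite mulr_ge0 ?yT0 // ltW.
  have [l [l0 sl xl]] := cx; exists l; split=> // j; rewrite inE negb_and.
  case/orP => [/sl//|yj]; have [jT|/sl//] := boolP (j \in T).
  apply/eqP; move: xy; rewrite xl (mul_dot_supp y sl); apply: contraTT => lj.
  rewrite -ltNge (bigD1 j) //= ltr_pwDl ?sumr_ge0 //.
    by rewrite mulr_gt0 // lt_def ?l0 ?lj ?yj ?yT0.
  by move=> i' /andP[i'T _]; rewrite mulr_ge0 // yT0.
left.
have {}H i : exists l, [/\ forall j, 0 <= l 0 j, suppd T l, x = l *m W & i \in T -> 0 < l 0 i].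
  have [iT|iT] := boolP (i \in T).
    have [[l [? ? ? ?]]|Hy] := positive_coord cx iT; first by exists l; split.
    by exfalso; apply: H; exists i.
  by have [l [? ? ?]] := cx; exists l; split.
have [L HL] := choice H.
have m0 : 0 < m%:R :> R.
  rewrite ltr0n; case: (posnP m) => // mE; move: x0.
  have [l [_ _ ->]] := cx; rewrite mul_dotE big1 ?ltxx // => i _.
  by have := ltn_ord i; rewrite {2}mE ltn0.
exists (m%:R^-1 *: \sum_i L i); split.
- move=> i iT; rewrite mxE summxE mulr_gt0 ?invr_gt0 // (bigD1 i) //= ltr_pwDl //.
    by have [_ _ _ ->] := HL i.
  by rewrite sumr_ge0 // => j _; have [-> _ _ _] := HL j.
- apply: suppdZ => i iT; rewrite summxE big1 // => j _.
  by have [_ sL _ _] := HL j; exact: sL.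
- rewrite -scalemxAl mulmx_suml (eq_bigr (fun=> x)) => [|i _].
    by rewrite sumr_const card_ord -scaler_nat scalerA mulVf ?scale1r // gt_eqF.
  by have [_ _ <- _] := HL i.
Qed.

Lemma face_relint_ex T x : conic_face T -> cone W T x -> 0 < (x *m h) 0 0 ->
  exists2 T' : {set 'I_m}, T' \subset T & conic_face T' /\ relint W T' x.
Proof.
move: {2}#|T| (leqnn #|T|) => c; elim: c T => [|c IH] T cT fT cx x0.
  have [rT|[T' /proper_card]] := face_cut fT cx x0; first by exists T.
  by move=> /leq_trans/(_ cT).
have [rT|[T' T'T [fT' cT']]] := face_cut fT cx x0; first by exists T.
have [|T'' T''T' H] := IH T' _ fT' cT' x0.
  by rewrite -ltnS (leq_trans (proper_card T'T)).
by exists T'' => //; apply: fintype.subset_trans (proper_sub T'T).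
Qed.

(** The functional exposing E vanishes at x; if it were positive at a generator in T, the positive
    coefficients on T would make it positive at x. *)
Lemma relint_cone_face E T x : conic_face E -> cone W E x -> relint W T x -> T \subset E.
Proof.
move=> [y Hy] [l [_ sl xl]] [l' [l0' sl' xl']].
have y0 : (x *m y) 0 0 = 0.
  rewrite xl (mul_dot_supp y sl) big1 // => i iE.
  by have /eqP -> : (W *m y) i 0 == 0; rewrite ?(Hy i).2 ?mulr0.
apply/fintype.subsetP => i iT; rewrite -(Hy i).2; move: y0; rewrite xl' (mul_dot_supp y sl').
apply: contra_eqT => yi; rewrite gt_eqF // (bigD1 i) //= ltr_pwDl //.
  by rewrite mulr_gt0 ?l0' // lt_def yi (Hy i).1.
by rewrite sumr_ge0 // => j /andP[jT _]; rewrite mulr_ge0 ?(Hy j).1 // ltW ?l0'.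
Qed.

Lemma relint_face_uniq E T x : conic_face E -> conic_face T ->
  relint W E x -> relint W T x -> E = T.
Proof.
move=> fE fT rE rT; apply/eqP; rewrite finset.eqEsubset.
by rewrite (relint_cone_face fT (relint_cone rT) rE) (relint_cone_face fE (relint_cone rE) rT).
Qed.

(** The functional exposing E vanishes on the span of E but not at a generator of F outside E. *)
Lemma face_rank E F : conic_face E -> E \proper F ->
  (\rank (span_mx W E) < \rank (span_mx W F))%N.
Proof.
move=> [y Hy] EF; have EsF := span_mxS W (proper_sub EF).
rewrite ltn_neqAle mxrankS // andbT; apply/negP => rEF.
have FE : (span_mx W F <= span_mx W E)%MS.
  have := mxrank_leqif_sup EsF; rewrite /leqif => -[_ <-] //.
have [_ [i iF iE]] := properP EF.
have : (row i W <= span_mx W E)%MS.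
  by apply: submx_trans FE; rewrite rowE; apply: sub_span_mx; exact: suppd_delta.
move=> rE; have := (coord_mxK rE); set l := coord_mx _ _ _ => lW.
have sl : suppd E l by apply: suppd_coord_mx.
have : (W *m y) i 0 = 0.
  have -> : (W *m y) i 0 = (row i W *m y) 0 0 by rewrite -row_mul [RHS]mxE.
  rewrite -lW (mul_dot_supp y sl) big1 // => j jE.
  by have /eqP -> : (W *m y) j 0 == 0; rewrite ?(Hy j).2 ?mulr0.
by move=> /eqP; rewrite (Hy i).2 (negPf iE).
Qed.

Lemma span_mx_rank_gt0 T i : i \in T -> (0 < \rank (span_mx W T))%N.
Proof.
move=> iT; rewrite lt0n mxrank_eq0; apply/eqP => s0.
have : (row i W <= span_mx W T)%MS by rewrite rowE; apply: sub_span_mx; exact: suppd_delta.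
rewrite s0 => /submx0null wi; have : (row i W *m h) 0 0 = 1 by rewrite -row_mul Wh !mxE.
by rewrite wi mul0mx mxE => /esym/eqP; rewrite oner_eq0.
Qed.

Lemma card_faces_relint F x : conic_face F -> 0 < (x *m h) 0 0 ->
  (\sum_(E : {set 'I_m} | `[< conic_face E >] && (E \subset F)) `[< relint W E x >] =
     `[< cone W F x >])%N.
Proof.
move=> fF x0; case: (asboolP (cone W F x)) => [cx|ncx].
  have [E EF [fE rE]] := face_relint_ex fF cx x0.
  have fE' : `[< conic_face E >] by apply/asboolP.
  rewrite (bigD1 E) /=; last by rewrite fE'.
  have -> : `[< relint W E x >] by apply/asboolP.
  rewrite big1 // => E' /andP[/andP[/asboolP fE'' E'F] E'E].
  case: asboolP => // rE'; case/eqP: E'E; exact: relint_face_uniq rE' rE.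
rewrite big1 // => E /andP[_ EF]; case: asboolP => // rE; case: ncx.
exact: coneS (relint_cone rE).
Qed.

End Faces.

(** * Weighted Ehrhart reciprocity *)

Section RoundDown.
Variable R : realType.
Implicit Types (b : bool) (x : R).

(* x - round_down b x lies in [0, 1[ if b holds, and in ]0, 1] otherwise, as
   befits a coordinate whose facet is closed, resp. open. *)
Definition round_down b x : int := if b then Num.floor x else Num.ceil x - 1.

Lemma round_down_le b x : (round_down b x)%:~R <= x.
Proof. by case: b; rewrite /round_down; [exact: floor_le|exact/ltW/ceilB1_lt]. Qed.

Lemma round_down_ge b x : x <= (round_down b x)%:~R + 1.
Proof.
case: b; rewrite /round_down; last by rewrite rmorphB /= subrK ceil_ge.
by apply/ltW; have := floorD1_gt x; rewrite rmorphD.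
Qed.

Lemma round_down_ge0 b x : (0 <= round_down b x) = if b then 0 <= x else 0 < x.
Proof. by case: b; rewrite /round_down ?floor_ge0 // -ceil_gt0; lia. Qed.

Lemma round_down_lt0 b x : (round_down b x < 0) = if b then x < 0 else x <= 0.
Proof. by rewrite ltNge round_down_ge0; case: b; rewrite -?ltNge -?leNgt. Qed.

Lemma round_downDb b x (c : bool) : round_down b (x + c%:R) = round_down b x + c%:R.
Proof.
have ci : (c%:R : R) \is a Num.int by case: c.
by case: b; rewrite /round_down ?floorDrz // ?ceilDrz //; case: c {ci};
  rewrite ?floor0 ?floor1 ?ceil0 ?ceil1 //= ?addr0 // addrAC.
Qed.

End RoundDown.

Lemma prod_nat_bool (K : comNzRingType) (I : finType) (S : {set I}) (b : I -> bool) :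
  \prod_(i in S) ((b i)%:R : K) = [forall i in S, b i]%:R.
Proof.
case: (boolP [forall i in S, b i]) => [/forall_inP H|].
  by rewrite big1 // => i iS; rewrite H.
rewrite negb_forall_in => /exists_inP[i iS /negPf bi].
by rewrite (bigD1 i) //= bi mul0r.
Qed.

(** * Lattice points in the height slices of the cone over a polytope *)

Section Lattice.
Variables (R : realType) (K : numDomainType) (n k : nat) (B : 'M[R]_n).
Variables (v : 'I_k.+1 -> 'rV[R]_n) (zs : 'I_k.+1 -> 'rV[int]_n).
Hypothesis B_unit : B \in unitmx.
Hypothesis v_lat : forall i, v i = lat B (zs i).

Definition homog_mx : 'M[R]_(k.+1, 1 + n) := \matrix_i row_mx (1 : 'rV[R]_1) (v i).
Definition height_vec : 'cV[R]_(1 + n) := col_mx 1 0.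
Definition homog_pt (s : int) (z : 'rV[int]_n) : 'rV[R]_(1 + n) :=
  row_mx ((s%:~R)%:M : 'rV[R]_1) (lat B z).

Lemma latD z w : lat B (z + w) = lat B z + lat B w.
Proof. by rewrite /lat map_mxD mulmxDl. Qed.

Lemma latN z : lat B (- z) = - lat B z.
Proof. by rewrite /lat map_mxN mulNmx. Qed.

Lemma lat_inj : injective (lat B).
Proof.
move=> z w /(congr1 (mulmx^~ (invmx B))); rewrite /lat !mulmxK // => /rowP E.
by apply/rowP => j; have := E j; rewrite !mxE => /intr_inj.
Qed.

Lemma homog_ptD s t z w : homog_pt (s + t) (z + w) = homog_pt s z + homog_pt t w.
Proof. by rewrite /homog_pt latD intrD raddfD add_row_mx. Qed.

Lemma homog_ptN s z : homog_pt (- s) (- z) = - homog_pt s z.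
Proof. by rewrite /homog_pt latN mulrNz raddfN opp_row_mx. Qed.

Lemma row_homog_mx i : row i homog_mx = homog_pt 1 (zs i).
Proof. by rewrite rowK /homog_pt v_lat. Qed.

Lemma homog_mx_height : homog_mx *m height_vec = const_mx 1.
Proof.
apply/row_matrixP => i; rewrite row_mul rowK mul_row_col mulmx0 addr0 mulmx1.
by apply/rowP => j; rewrite !ord1 !mxE.
Qed.

Lemma homog_pt_height s z : (homog_pt s z *m height_vec) 0 0 = s%:~R.
Proof.
rewrite /homog_pt mul_row_col mulmx0 addr0 mulmx1.
by rewrite mxE eqxx.
Qed.

(** In the basis B, the coordinates of z are combinations of those of the generators with bounded
    coefficients. So z lies in a box, enumerated by [f] after a shift by M. *)
Lemma bounded_finite s (b : R) : finite_set [set z |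
  exists2 l : 'rV[R]_k.+1, forall i, `|l 0 i| <= b & homog_pt s z = l *m homog_mx].
Proof.
pose Z : 'M[R]_(k.+1, n) := \matrix_i map_mx (fun a : int => a%:~R) (zs i).
pose C : R := \sum_i \sum_j `|Z i j|.
have C0 : 0 <= C by do 2! (apply: sumr_ge0 => ? _).
pose M := (Num.trunc (`|b| * C)).+1.
pose f (g : {ffun 'I_n -> 'I_(M + M).+1}) : 'rV[int]_n := \row_j ((g j)%:Z - M%:Z).
have : finite_set [set f g | g in [set: {ffun 'I_n -> 'I_(M + M).+1}]].
  by apply: finite_image; exact: finite_finset.
apply: sub_finite_set => z /= [l lb zl].
have zE : map_mx (fun a : int => a%:~R) z = l *m Z.
  apply: (can_inj (mulmxK B_unit)); rewrite -[LHS]/(lat B z).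
  have -> : lat B z = rsubmx (homog_pt s z) by rewrite row_mxKr.
  have WE : homog_mx = row_mx (const_mx 1) (Z *m B).
    apply/row_matrixP => i; rewrite row_row_mx rowK row_mul rowK v_lat.
    by congr row_mx; apply/rowP => j; rewrite !ord1 !mxE.
  by rewrite zl WE mul_mx_row row_mxKr mulmxA.
have zb j : (`|(z 0 j)%R| <= M)%N.
  rewrite -(ler_nat R) natr_absz intr_norm; move/rowP/(_ j): zE; rewrite mxE => ->.
  rewrite mxE (le_trans (ler_norm_sum _ _ _)) // (@le_trans _ _ (`|b| * C)) //.
    rewrite /C mulr_sumr ler_sum // => i _; rewrite normrM ler_pM //.
      by rewrite (le_trans (lb i)) // ler_norm.
    by rewrite (bigD1 j) //= lerDl sumr_ge0.
  by apply/ltW/truncnS_gt.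
exists [ffun j => inord `|(z 0 j + M%:Z)%R|%N] => //.
apply/rowP => j; rewrite mxE ffunE inordK; have := zb j; lia.
Qed.

Section Reciprocity.
Variables (T : {set 'I_k.+1}).

Local Notation W := homog_mx.
Local Notation coord_mx := (coord_mx W).

Section Cell.
Variables (S : {set 'I_k.+1}) (xi : 'rV[R]_(1 + n)).
Hypothesis S_basis : basis W T S.
Hypothesis xi_ne0 : forall i, i \in S -> coord_mx S xi 0 i != 0.

Definition inspan s z := (homog_pt s z <= span_mx W T)%MS.
Definition rcoord i s z := round_down (0 < coord_mx S xi 0 i) (coord_mx S (homog_pt s z) 0 i).

Lemma cell_row i : i \in S -> (row i W <= span_mx W T)%MS.
Proof.
move=> iS; have /and3P[ST _ _] := S_basis; rewrite rowE; apply: sub_span_mx.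
by apply: suppd_delta; exact: (fintype.subsetP ST).
Qed.

Lemma inspan_shift i s z : i \in S -> inspan (s + 1) (z + zs i) = inspan s z.
Proof.
move=> iS; rewrite /inspan homog_ptD -row_homog_mx; apply/idP/idP => H.
  rewrite -[homog_pt s z](addrK (row i W)); apply: addmx_sub => //.
  by rewrite eqmx_opp; exact: cell_row.
by apply: addmx_sub => //; exact: cell_row.
Qed.

Lemma rcoord_shift i j s z : i \in S -> j \in S -> inspan s z ->
  rcoord j (s + 1) (z + zs i) = rcoord j s z + (i == j)%:R.
Proof.
move=> iS jS _; rewrite /rcoord homog_ptD coord_mxD -row_homog_mx [row i W]rowE coord_mx_uniq.
- by rewrite !mxE eqxx /= [j == i]eq_sym round_downDb.
- by have /and3P[] := S_basis.
- exact: suppd_delta.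
Qed.

Local Notation sg := (@signed_ind _ K _ S inspan rcoord).

Lemma sum_crd_inspan s z : inspan s z -> \sum_(i in S) coord_mx S (homog_pt s z) 0 i = s%:~R.
Proof.
move=> cz; have xS := basis_sub S_basis cz.
rewrite -(homog_pt_height s z) -(sum_coord_mx homog_mx_height (esym (coord_mxK xS))).
rewrite [RHS](bigID (fun i => i \in S)) /= [X in _ + X]big1 ?addr0 // => i iS.
by rewrite suppd_coord_mx.
Qed.

Lemma coord_bound (f : 'I_k.+1 -> R) (c : R) : (forall i, i \in S -> -1 <= f i) ->
  \sum_(i in S) f i <= c -> forall i, i \in S -> f i <= c + k.+1%:R.
Proof.
move=> f1 fc i iS; move: fc; rewrite (bigD1 i) //= => fc.
have : - k.+1%:R <= \sum_(j in S | j != i) f j.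
  rewrite (@le_trans _ _ (\sum_(j in S | j != i) -1)) //; last first.
    by apply: ler_sum => j /andP[jS _]; exact: f1.
  rewrite sumr_const mulNrn lerN2 ler_nat.
  by rewrite (leq_trans (max_card _)) // card_ord.
lra.
Qed.

Lemma signed_ind_support (J : {set 'I_k.+1}) s z : J \subset S -> sg J s z != 0 ->
  inspan s z /\ ((forall i, i \in S -> 0 <= rcoord i s z) \/
              (forall i, i \in S -> rcoord i s z <= 0)).
Proof.
rewrite /signed_ind => JS; case: (inspan s z); last by rewrite mul0r eqxx.
case: forall_inP => /= [H0|]; last by rewrite mul0r eqxx.
rewrite mul1r => H; split=> //.
have [P|nP] := boolP [forall i in J, 0 <= rcoord i s z].
  left=> i iS; have [iJ|iJ] := boolP (i \in J); first by have /forall_inP -> := P.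
  by rewrite (eqP (H0 i _)) // inE iJ.
have [P|nP'] := boolP [forall i in J, rcoord i s z < 0].
  right=> i iS; have [iJ|iJ] := boolP (i \in J).
    by apply: ltW; have /forall_inP -> := P.
  by rewrite (eqP (H0 i _)) // inE iJ.
move: H; rewrite prod_nat_bool (negPf nP) sub0r.
move: nP'; rewrite negb_forall_in => /exists_inP[i iJ /negPf ki].
by rewrite (bigD1 i) //= ki oppr0 mul0r oppr0 eqxx.
Qed.

Lemma signed_ind_fin (J : {set 'I_k.+1}) s : J \subset S -> fsupp (sg J s).
Proof.
(* The coordinates sum to s and are all >= -1 or all <= 1, the 1 coming from rounding; this costs at
   most one unit per generator, of which there are k + 1. *)
move=> JS; pose b : R := `|s%:~R| + k.+1%:R.
have b0 : 0 <= b by rewrite addr_ge0.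
apply: sub_finite_set (bounded_finite s b) => z /= /(signed_ind_support JS)[cz Hk].
have xS := basis_sub S_basis cz; exists (coord_mx S (homog_pt s z)); last by rewrite coord_mxK.
move=> i; have [iS|iS] := boolP (i \in S); last by rewrite suppd_coord_mx ?normr0.
have b1 : 1 <= b by rewrite ler_wpDl // (ler_nat R 1).
case: Hk => Hk.
  have c0 j : j \in S -> 0 <= coord_mx S (homog_pt s z) 0 j.
    by move=> jS; apply: le_trans (round_down_le (0 < coord_mx S xi 0 j) _); rewrite ler0z Hk.
  rewrite ger0_norm ?c0 //; apply: (coord_bound (f := fun j => coord_mx S (homog_pt s z) 0 j)) => //.
    by move=> j jS; rewrite (le_trans _ (c0 j jS)) // lerN10.
  by rewrite sum_crd_inspan // ler_norm.
have c1 j : j \in S -> -1 <= - coord_mx S (homog_pt s z) 0 j.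
  move=> jS; rewrite lerN2 (le_trans (round_down_ge (0 < coord_mx S xi 0 j) _)) //.
  by rewrite gerDr lerz0 Hk.
rewrite ler_norml; apply/andP; split.
  rewrite lerNl; apply: (coord_bound (f := fun j => - coord_mx S (homog_pt s z) 0 j)) => //.
  by rewrite sumrN sum_crd_inspan // -normrN ler_norm.
by rewrite (le_trans _ b1) // -lerN2 c1.
Qed.

(** Nothing is frozen for J = S. As no coordinate of xi is 0, rounding makes [0 <= rcoord] the
    half-open condition at x in direction xi, and [rcoord < 0] the one at -x in direction -xi. *)
Lemma signed_ind_halfopen s z : sg S s z =
  (`[< halfopen W T S xi (homog_pt s z) >]%:R -
   (-1) ^+ #|S| * `[< halfopen W T S (- xi) (- homog_pt s z) >]%:R).
Proof.
have xS eta x : `[< halfopen W T S eta x >] = (x <= span_mx W T)%MS &&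
   [forall i in S, (0 < coord_mx S x 0 i) || ((coord_mx S x 0 i == 0) && (0 < coord_mx S eta 0 i))].
  apply/asboolP/andP => [[xT H]|[xT /forall_inP H]]; split=> //.
    apply/forall_inP => i /H[->//|[-> ->]]; by rewrite eqxx orbT.
  move=> i /H/orP[|/andP[/eqP ? ?]]; by [left|right].
rewrite !xS eqmx_opp -/(inspan s z) /signed_ind finset.setDv.
have -> : [forall i in finset.set0, rcoord i s z == 0] by apply/forall_inP => i; rewrite inE.
rewrite andbT; case: (inspan s z); last by rewrite !mul0r mulr0 subrr.
rewrite mul1r prod_nat_bool /=; congr ((nat_of_bool _)%:R - _).
  apply: eq_forallb_in => i iS; rewrite /rcoord round_down_ge0.
  by have := xi_ne0 iS; case: (ltgtP 0 (coord_mx S xi 0 i)) => //= _ _;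
    rewrite ?andbT ?andbF ?orbF // le_eqVlt orbC eq_sym.
rewrite (eq_bigr (fun i => -1 * (rcoord i s z < 0)%R%:R)); last by move=> i _; rewrite mulN1r.
rewrite big_split /= prodr_const prod_nat_bool; congr (_ * (nat_of_bool _)%:R).
apply: eq_forallb_in => i iS; rewrite /rcoord round_down_lt0.
rewrite -(scaleN1r (homog_pt s z)) -(scaleN1r xi) !coord_mxZ !mxE !mulN1r !oppr_gt0 oppr_eq0.
by have := xi_ne0 iS; case: (ltgtP 0 (coord_mx S xi 0 i)) => //= _ _;
  rewrite ?andbT ?andbF ?orbF // le_eqVlt orbC.
Qed.

End Cell.

Definition cone_ind s z : K := `[< cone W T (homog_pt s z) >]%:R.
Definition relint_ind s z : K := `[< relint W T (homog_pt s z) >]%:R.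

Lemma cone_ind_fin s : fsupp (cone_ind s).
Proof.
apply: sub_finite_set (bounded_finite s (s%:~R)) => z /=; rewrite /cone_ind.
case: asboolP => [[l [l0 sl zl]] _|]; last by rewrite eqxx.
exists l => // i; rewrite ger0_norm //; have := sum_coord_mx homog_mx_height zl; rewrite homog_pt_height => <-.
by rewrite (bigD1 i) //= lerDl sumr_ge0.
Qed.

Lemma relint_ind_fin s : fsupp (relint_ind s).
Proof.
apply: sub_finite_set (cone_ind_fin s) => z /=; rewrite /cone_ind /relint_ind.
case: asboolP => [rz _|]; last by rewrite eqxx.
have -> : `[< cone W T (homog_pt s z) >] by apply/asboolP; exact: relint_cone.
exact: oner_neq0.
Qed.

(* For s > 0 only the first indicator contributes, for s < 0 only the second one:
   this is the reciprocity law. *)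
Theorem polfun_reciprocity (phi : 'rV[int]_n -> K) : polfun phi ->
  polfun (fun s => fsum (fun z => (cone_ind s z -
    (-1) ^+ \rank (span_mx W T) * relint_ind (- s) (- z)) * phi z)).
Proof.
move=> Hphi; have [xi rxi gxi] := generic_relint_ex W T.
have [c cg] := cost_generic_ex W T.
(* Every cell is a basis of the span of T, so all cells have the same cardinality and their common
   sign factors out. *)
have cell S : S \in cells W T c -> [/\ basis W T S, #|S| = \rank (span_mx W T) &
   forall i, i \in S -> coord_mx S xi 0 i != 0].
  move=> /cellsP[bS _]; split=> //; last by move=> i iS; apply: generic_coord_mx bS gxi iS.
  have /and3P[ST TS /eqP <-] := bS.
  by apply/eqP; rewrite eqn_leq !mxrankS // span_mxS.
apply: (@polfun_eq _ _ (fun s => \sum_(S in cells W T c)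
    fsum (fun z => signed_ind K S inspan (rcoord S xi) S s z * phi z))); last first.
  apply: polfun_sum => S /cell[bS _ x0]; apply: (@polfun_signed_sum _ _ _ _ zs) => //.
  - by move=> i s z; exact: inspan_shift.
  - by move=> i j s z; exact: rcoord_shift.
  - by move=> J s; exact: signed_ind_fin.
move=> s; rewrite -fsum_sum; last first.
  by move=> S /cell[bS _ x0]; apply: fsuppMr; exact: signed_ind_fin.
apply: fsum_eq => z; rewrite -mulr_suml; congr (_ * _).
rewrite (eq_bigr (fun S => `[< halfopen W T S xi (homog_pt s z) >]%:R -
   (-1) ^+ \rank (span_mx W T) * `[< halfopen W T S (- xi) (- homog_pt s z) >]%:R)); last first.
  by move=> S /cell[bS <- x0]; exact: signed_ind_halfopen.
rewrite sumrB -mulr_sumr -!natr_sum; congr (_ - _ * _).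
  by rewrite (cone_cells homog_mx_height cg rxi gxi).
by rewrite (relint_cells homog_mx_height cg rxi gxi) /relint_ind homog_ptN.
Qed.

End Reciprocity.

End Lattice.

(** Lagrange interpolation: psi kills the support away from z0, each factor being an affine function
    of one coordinate in which z and z0 differ. *)
Lemma separate_fsum (K : numDomainType) (n : nat) (a : 'rV[int]_n -> K) :
  fsupp a -> (forall psi, polfun psi -> fsum (fun z => a z * psi z) = 0) ->
  forall z, a z = 0.
Proof.
move=> /finite_seqP[s sE] Ha z0.
pose lin (z x : 'rV[int]_n) : K :=
  if [pick j | z 0 j != z0 0 j] is Some j then (x 0 j - z 0 j)%:~R else 1.
pose psi x := \prod_(z <- s | z != z0) lin z x.
have pol_lin z : polfun (lin z).
  rewrite /lin; case: pickP => [j _|_]; last exact: polfun_cst.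
  apply: (@polfun_eq _ _ (fun x : 'rV[int]_n => (x 0 j)%:~R + - (z 0 j)%:~R : K)).
    by move=> x; rewrite intrB.
  apply: polfunD; last exact: polfun_cst.
  by apply: polfun_additive => x y; rewrite mxE intrD.
have pol_psi : polfun psi by apply: polfun_prod => z _; exact: pol_lin.
have psi0 : psi z0 != 0.
  rewrite prodf_seq_neq0; apply/allP => z _; apply/implyP => zz0.
  rewrite /lin; case: pickP => [j|_]; last exact: oner_neq0.
  by rewrite intr_eq0 subr_eq0 eq_sym.
have := Ha psi pol_psi; rewrite (fsum_single (z0 := z0)) => [/eqP|z zz0].
  by rewrite mulf_eq0 (negPf psi0) orbF => /eqP.
have [->|az] := eqVneq (a z) 0; first by rewrite mul0r.
have zs : z \in s by have : [set` s]%classic z by rewrite -sE.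
rewrite /psi (big_rem z) //= zz0 {1}/lin; case: pickP => [j _|H].
  by rewrite subrr mul0r mulr0.
case/eqP: zz0; apply/rowP => j; have := H j.
by move=> /negbFE/eqP.
Qed.

(** * Euler's relation for intervals of faces *)

Section Euler.
Variables (R : realType) (K : numDomainType) (n k : nat) (B : 'M[R]_n).
Variables (v : 'I_k.+1 -> 'rV[R]_n) (zs : 'I_k.+1 -> 'rV[int]_n).
Hypothesis B_unit : B \in unitmx.
Hypothesis v_lat : forall i, v i = lat B (zs i).

Local Notation W := (homog_mx v).
Local Notation homog_pt := (homog_pt B).
Local Notation inC := (cone_ind K B v).
Local Notation inR := (relint_ind K B v).
Local Notation rk T := (\rank (span_mx W T)).
Implicit Types (T E F G : {set 'I_k.+1}) (q : nat) (z : 'rV[int]_n).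
Implicit Types (phi : 'rV[int]_n -> K).

Definition ehr T phi (s : int) : K :=
  fsum (fun z => (inC T s z - (-1) ^+ rk T * inR T (- s) (- z)) * phi z).

Lemma polfun_ehr T phi : polfun phi -> polfun (ehr T phi).
Proof. exact: (polfun_reciprocity B_unit v_lat). Qed.

Lemma cone_homog_pt_ge0 T s z : cone W T (homog_pt s z) -> 0 <= s.
Proof.
move=> /(cone_height (homog_mx_height v)); rewrite homog_pt_height.
by rewrite ler0z.
Qed.

Lemma ehr_pos T phi q : (0 < q)%N ->
  ehr T phi q%:Z = fsum (fun z => inC T q%:Z z * phi z).
Proof.
move=> q0; apply: fsum_eq => z; congr (_ * _).
rewrite /relint_ind; case: asboolP => [/relint_cone/cone_homog_pt_ge0|_]; last by rewrite mulr0 subr0.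
by rewrite oppr_ge0 lez_nat leqNgt q0.
Qed.

Lemma ehr_neg T phi q : (0 < q)%N ->
  ehr T phi (- q%:Z) = - (-1) ^+ rk T * fsum (fun z => inR T q%:Z z * phi (- z)).
Proof.
move=> q0; rewrite -fsumMl.
have oppb : bijective (fun z : 'rV[int]_n => - z) by exists -%R; exact: opprK.
rewrite [RHS](fsum_reindex _ oppb); apply: fsum_eq => z /=.
rewrite !opprK mulrA; congr (_ * _).
rewrite /cone_ind; case: asboolP => [/cone_homog_pt_ge0|_]; last by rewrite sub0r mulNr.
by rewrite oppr_ge0 lez_nat leqNgt q0.
Qed.

Lemma cone_ind_faces F q z : conic_face W F -> (0 < q)%N ->
  inC F q%:Z z = \sum_(E : {set 'I_k.+1} | `[< conic_face W E >] && (E \subset F))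
     inR E q%:Z z.
Proof.
move=> fF q0; rewrite /cone_ind -(card_faces_relint (homog_mx_height v) fF) ?natr_sum //.
by rewrite homog_pt_height ltr0z.
Qed.

(** At positive s this cuts the cone into the relative interiors of its faces, each rewritten by
    [ehr_neg]. Both sides are polynomial in s, so it extends to negative s, where it is used. *)
Lemma ehr_faces F phi (s : int) : conic_face W F -> polfun phi ->
  ehr F phi s = \sum_(E : {set 'I_k.+1} | `[< conic_face W E >] && (E \subset F))
     - (-1) ^+ rk E * ehr E (fun z => phi (- z)) (- s).
Proof.
move=> fF Hphi; have Hphi' : polfun (fun z => phi (- z)).
  by apply: (polfun_comp (h := -%R)) => // x y; rewrite opprD.
apply: (@polfun_ext _ (ehr F phi) (fun s => \sum_(E : {set 'I_k.+1} | _) _)).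
- exact: polfun_ehr.
- apply: polfun_sum => E _; apply: polfunM; first exact: polfun_cst.
  apply: (polfun_comp (h := -%R) (f := ehr E (fun z => phi (- z)))).
    by move=> x y; rewrite opprD.
  exact: polfun_ehr.
move=> q q0; rewrite ehr_pos //.
rewrite (eq_bigr (fun E : {set 'I_k.+1} => fsum (fun z => inR E q%:Z z * phi z))).
  rewrite -fsum_sum; last by move=> E _; apply: fsuppMr; exact: (relint_ind_fin _ B_unit v_lat).
  by apply: fsum_eq => z; rewrite cone_ind_faces // mulr_suml.
move=> E _; rewrite ehr_neg // mulrA mulrNN -expr2 sqrr_sign mul1r.
by apply: fsum_eq => z; rewrite opprK.
Qed.

(* [ehr_faces] at a negative argument, rewritten by reciprocity on both sides, is
   this identity summed against an arbitrary polynomial weight. *)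
Lemma cone_ind_alternate F q z : conic_face W F -> (0 < q)%N ->
  \sum_(E : {set 'I_k.+1} | `[< conic_face W E >] && (E \subset F))
    (-1) ^+ rk E * inC E q%:Z z = (-1) ^+ rk F * inR F q%:Z z.
Proof.
move=> fF q0; apply/eqP; rewrite -subr_eq0; apply/eqP; move: z.
have cfin E : fsupp (fun z => (-1) ^+ rk E * inC E q%:Z z).
  rewrite (_ : (fun z => _) = fun z => inC E q%:Z z * (-1) ^+ rk E).
    by apply: fsuppMr; exact: (cone_ind_fin _ B_unit v_lat).
  by apply/funext => z; rewrite mulrC.
have rfin : fsupp (fun z => inR F q%:Z z * - (-1) ^+ rk F).
  by apply: fsuppMr; exact: (relint_ind_fin _ B_unit v_lat).
have sfin : fsupp (fun z => \sum_(E : {set 'I_k.+1} | `[< conic_face W E >] && (E \subset F))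
    (-1) ^+ rk E * inC E q%:Z z) by apply: fsupp_sum.
apply: separate_fsum.
  rewrite (_ : (fun z => _) = fun z => \sum_(E : {set 'I_k.+1} |
     `[< conic_face W E >] && (E \subset F))
    (-1) ^+ rk E * inC E q%:Z z + inR F q%:Z z * - (-1) ^+ rk F).
    exact: fsuppD.
  by apply/funext => z; rewrite mulrN mulrC.
move=> psi Hpsi; pose phi z := psi (- z).
have Hphi : polfun phi by apply: (polfun_comp (h := -%R)) => // x y; rewrite opprD.
have phiN : (fun z => phi (- z)) = psi by apply/funext => z; rewrite /phi opprK.
have := ehr_faces (- q%:Z) fF Hphi; rewrite opprK phiN ehr_neg //.
have -> : fsum (fun z => inR F q%:Z z * phi (- z)) = fsum (fun z => inR F q%:Z z * psi z).
  by apply: fsum_eq => z; rewrite /phi opprK.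
rewrite mulNr (eq_bigr (fun E : {set 'I_k.+1} =>
   - fsum (fun z => (-1) ^+ rk E * inC E q%:Z z * psi z))); last first.
  move=> E _; rewrite mulNr ehr_pos // -fsumMl; congr (- _).
  by apply: fsum_eq => z; rewrite mulrA.
rewrite sumrN => /oppr_inj; rewrite -fsum_sum => [E|E _]; last exact: fsuppMr.
move/esym/eqP: E; rewrite -subr_eq0 => /eqP E; apply: etrans E.
rewrite -fsumMl -[X in _ = _ + X]mulN1r -fsumMl -fsumD.
- by apply: fsum_eq => z; rewrite mulrBl mulr_suml mulN1r !mulrA.
- by apply: fsupp_sum => E' _; exact: fsuppMr.
- rewrite (_ : (fun z => _) = fun z => inR F q%:Z z * (- 1 * ((-1) ^+ rk F * psi z))).
    by apply: fsuppMr; exact: (relint_ind_fin _ B_unit v_lat).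
  by apply/funext => z; ring.
Qed.

Lemma face_euler G F : conic_face W G -> conic_face W F -> G != finset.set0 ->
  G \proper F ->
  \sum_(E : {set 'I_k.+1} | [&& `[< conic_face W E >], G \subset E & E \subset F])
    (-1) ^+ rk E = 0 :> K.
Proof.
move=> fG fF G0 GF.
(* The sum of the generators of G is a lattice point in the relative interior of G, at positive
   height #|G|. It lies in the cone over a face E exactly when E contains G, and it is not in the
   relative interior of F. *)
pose z := \sum_(i in G) zs i.
have rG : relint W G (homog_pt #|G|%:Z z).
  exists (\row_i (i \in G)%:R); split.
  - by move=> i iG; rewrite mxE iG.
  - by move=> i iG; rewrite mxE (negPf iG).
  rewrite mulmx_sum_row (eq_bigr (fun i => if i \in G then homog_pt 1 (zs i) else 0)).
    rewrite -big_mkcond /= (_ : #|G|%:Z = \sum_(i in G) 1); last by rewrite sumr_const natz.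
    apply: (big_ind3 (fun s z x => homog_pt s z = x)) => // [|s1 s2 s3 z1 z2 z3 <- <-].
      by rewrite -[LHS](addrK (homog_pt 0 0)) -(homog_ptD B) !addr0 subrr.
    by rewrite homog_ptD.
  move=> i _; rewrite mxE (row_homog_mx v_lat); case: (i \in G); by rewrite ?scale1r ?scale0r.
have qG : (0 < #|G|)%N by rewrite card_gt0.
have := cone_ind_alternate z fF qG.
have -> : inR F #|G|%:Z z = 0.
  rewrite /relint_ind; case: asboolP => // rF.
  by move: GF; rewrite (relint_face_uniq fG fF rG rF) fintype.properxx.
rewrite mulr0 => H0; apply: etrans H0; rewrite [RHS](bigID (fun E : {set 'I_k.+1} => G \subset E)) /=.
rewrite [X in _ = _ + X]big1 ?addr0; last first.
  move=> E /andP[/andP[/asboolP fE EF] GE]; rewrite /cone_ind.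
  case: asboolP => [cE|]; last by rewrite mulr0.
  by rewrite (relint_cone_face fE cE rG) in GE.
apply: eq_big => E; first by rewrite -andbA [X in _ = _ && X]andbC.
move=> /and3P[fE GE EF]; rewrite /cone_ind.
case: asboolP => [_|[]]; first by rewrite mulr1.
exact: coneS GE (relint_cone rG).
Qed.

End Euler.

Lemma poly_eq_nat (K : numDomainType) (p r : {poly K}) :
  (forall q : nat, (0 < q)%N -> p.[q%:R] = r.[q%:R]) -> p = r.
Proof.
move=> H; apply/eqP; rewrite -subr_eq0; apply/eqP.
apply: (@roots_geq_poly_eq0 _ _ [seq i.+1%:R | i <- iota 0 (size (p - r))]).
- by apply/allP => _ /mapP[i _ ->]; rewrite /root hornerD hornerN H // subrr.
- by rewrite map_inj_uniq ?iota_uniq // => i j /eqP; rewrite eqr_nat => /eqP[].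
- by rewrite size_map size_iota.
Qed.

(** * Stanley's identity for g-polynomials *)

Section ReversePoly.
Variable K : numFieldType.
Implicit Types (p q : {poly int}) (x : K).

Definition int_horner p x : K := (map_poly intr p).[x].

Definition rev_poly r p : {poly int} := \poly_(i < r.+1) p`_(r - i).

Lemma int_horner_wide r p x : (size p <= r)%N -> int_horner p x = \sum_(i < r) (p`_i)%:~R * x ^+ i.
Proof.
move=> sp; rewrite /int_horner (@horner_coef_wide _ r); last first.
  by rewrite (leq_trans (size_poly _ _)).
by apply: eq_bigr => i _; rewrite coef_map.
Qed.

Lemma int_horner_revp r p x : (size p <= r.+1)%N -> x != 0 ->
  int_horner (rev_poly r p) x = x ^+ r * int_horner p x^-1.
Proof.
move=> sp x0; rewrite (@int_horner_wide r.+1) ?size_poly // (int_horner_wide _ sp) mulr_sumr.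
rewrite (reindex_inj rev_ord_inj) /=; apply: eq_bigr => i _.
have ir : (i <= r)%N by rewrite -ltnS.
rewrite coef_poly subSS ltnS leq_subr subKn // mulrCA exprVn; congr (_ * _).
have -> : x ^+ r = x ^+ (r - i) * x ^+ i by rewrite -exprD subnK.
by rewrite mulfK // expf_neq0.
Qed.

Lemma int_horner_inj p q : (forall x, x != 0 -> int_horner p x = int_horner q x) -> p = q.
Proof.
move=> H; have /polyP E : map_poly (intr : int -> K) p = map_poly intr q.
  by apply: poly_eq_nat => s s0; apply: H; rewrite pnatr_eq0 -lt0n.
by apply/polyP => i; have := E i; rewrite !coef_map => /intr_inj.
Qed.

(* [trunc_g] takes the lower half of - A = (1 - X) f, whose coefficient sequence
   is antisymmetric about r / 2. *)
Lemma trunc_antisym r (f : {poly int}) : (0 < r)%N ->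
  let A := ('X - 1) * f in
  (size A <= r.+1)%N ->
  (forall x, x != 0 -> x ^+ r * int_horner A x^-1 = - int_horner A x) ->
  forall x, x != 0 -> x ^+ r * int_horner (trunc_g (r - 1) f) x^-1 =
    int_horner (trunc_g (r - 1) f) x + int_horner A x.
Proof.
move=> r0 A sA HA x x0.
have revA : rev_poly r A = - A.
  apply: int_horner_inj => y y0; rewrite int_horner_revp // HA // /int_horner rmorphN /= hornerN.
  by [].
have cA i : (i <= r)%N -> A`_(r - i) = - A`_i.
  by move=> ir; move/polyP/(_ i): revA; rewrite coef_poly ltnS ir coefN.
pose m := ((r - 1)./2)%N; set g := trunc_g _ _.
have m2 : (m.*2 <= r - 1 <= m.*2.+1)%N.
  by rewrite /m -{2 3}(odd_double_half (r - 1)); case: (odd _) => /=; rewrite ?add1n ?add0n leqnn ?leqnSn.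
have gE i : g`_i = if (i <= m)%N then - A`_i else 0.
  rewrite coef_poly ltnS; case: ifP => // _.
  by rewrite /A mulrBl mul1r coefB coefXM; case: i => [|i] /=; rewrite ?subr0 ?sub0r ?opprK ?opprB.
have sg : (size g <= r.+1)%N.
  apply: leq_trans (size_poly _ _) _; rewrite -/m; lia.
rewrite -int_horner_revp // /int_horner -hornerD -rmorphD /=; congr (_.[x]); congr map_poly.
apply/polyP => i; rewrite coef_poly ltnS coefD !gE; case: leqP => ir; last first.
  rewrite ifF ?add0r; last by apply/negbTE; rewrite -ltnNge; lia.
  by apply/esym/nth_default; rewrite (leq_trans sA).
have [im|im] := leqP i m.
  by rewrite ifF ?addNr //; apply/negbTE; rewrite -ltnNge; lia.
rewrite add0r; case: ifP => rim; first by rewrite cA // opprK.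
(* The middle coefficient, at r = 2 i, is its own negative. *)
have ri : (r - i = i)%N by lia.
by have := cA i ir; rewrite ri => /eqP; rewrite -addr_eq0 -mulr2n mulrn_eq0 /= => /eqP ->.
Qed.

End ReversePoly.

Section GPolynomial.
Variables (K : numFieldType) (I : finType) (faceb : pred {set I}) (dm : {set I} -> nat) (n : nat).
Hypothesis dmT : dm finset.setT = n.
Hypothesis faceT : faceb finset.setT.
Hypothesis dm_lt : forall E F, faceb E -> faceb F -> E \proper F -> (dm E < dm F)%N.
Hypothesis euler : forall G F, faceb G -> faceb F -> G \proper F ->
  \sum_(E | [&& faceb E, G \subset E & E \subset F]) (-1) ^+ dm E = 0 :> K.
Variable g : {set I} -> {poly int}.
Hypothesis g_top : g finset.setT = 1.
Hypothesis g_rec : forall T, faceb T -> T != finset.setT ->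
  g T = trunc_g (n - 1 - dm T)
    (\sum_(H | faceb H && (T \proper H)) g H * ('X - 1) ^+ (dm H - dm T - 1)).

Lemma dm_le E F : faceb E -> faceb F -> E \subset F -> (dm E <= dm F)%N.
Proof.
move=> fE fF EF; have [->//|EF'] := eqVneq E F.
by apply/ltnW/dm_lt => //; rewrite finset.properEneq EF' EF.
Qed.

Lemma size_g H : faceb H -> (size (g H) <= (n - dm H).+1)%N.
Proof.
move=> fH; have [->|HT] := eqVneq H finset.setT; first by rewrite g_top size_poly1.
rewrite g_rec //; apply: leq_trans (size_poly _ _) _; rewrite ltnS.
by rewrite (leq_trans (half_leq (leq_sub2r (dm H) (leq_subr 1 n)))) // -divn2 leq_div.
Qed.

Lemma g_reciprocity_top (x : K) :
  x ^+ (n - dm finset.setT) * int_horner (g finset.setT) x^-1 =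
  \sum_(H | faceb H && (finset.setT \subset H))
     int_horner (g H) x * (x - 1) ^+ (dm H - dm finset.setT).
Proof.
rewrite (big_pred1 finset.setT) => [|H]; last first.
  by rewrite finset.subTset /=; case: eqP => [->|_]; rewrite ?faceT ?andbF.
by rewrite dmT subnn !expr0 mul1r mulr1 g_top /int_horner rmorph1 !hornerE.
Qed.

(** Induction on the codimension. The crux is the antisymmetry of A = (X - 1) f under inversion:
    expand each H above T by the induction hypothesis, with 1 - y = -(y - 1). The term of L then
    carries the sum of (-1)^(dim H - dim T) over T < H <= L, which is -1 by Euler's relation. *)
Theorem g_reciprocity T : faceb T -> forall x : K, x != 0 ->
  x ^+ (n - dm T) * int_horner (g T) x^-1 =
  \sum_(H | faceb H && (T \subset H)) int_horner (g H) x * (x - 1) ^+ (dm H - dm T).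
Proof.
move: {2}(n - dm T)%N (leqnn (n - dm T)) => c; elim: c T => [|c IH] T cT fT x x0.
all: have [->|TT] := eqVneq T finset.setT; first exact: g_reciprocity_top.
  have : (dm T < n)%N by rewrite -dmT dm_lt // properE finset.subsetT finset.subTset TT.
  by move: cT; lia.
have dTn : (dm T < n)%N by rewrite -dmT dm_lt // properE finset.subsetT finset.subTset TT.
set f := \sum_(H | faceb H && (T \proper H)) g H * ('X - 1) ^+ (dm H - dm T - 1).
have AE : ('X - 1) * f = \sum_(H | faceb H && (T \proper H)) g H * ('X - 1) ^+ (dm H - dm T).
  rewrite mulr_sumr; apply: eq_bigr => H /andP[fH TH].
  rewrite mulrCA -exprS; congr (_ * _ ^+ _).
  by have := dm_lt fT fH TH; lia.
have pevA y : int_horner (('X - 1) * f) y =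
   \sum_(H | faceb H && (T \proper H)) int_horner (g H) y * (y - 1) ^+ (dm H - dm T) :> K.
  rewrite AE /int_horner rmorph_sum horner_sum; apply: eq_bigr => H _.
  by rewrite rmorphM rmorphXn rmorphB /= map_polyX rmorph1 !hornerE.
have split_T (F : {set I} -> K) : \sum_(H | faceb H && (T \subset H)) F H =
    F T + \sum_(H | faceb H && (T \proper H)) F H.
  rewrite (bigD1 T) /=; last by rewrite fT fintype.subxx.
  congr (_ + _); apply: eq_bigl => H; rewrite finset.properEneq -andbA; congr (_ && _).
  by rewrite andbC eq_sym.
(* The term H = T is g_T(x) and the others add up to A(x), which is the shape of [trunc_antisym]
   with r = n - dim T. *)
rewrite split_T subnn mulr1 -pevA.
rewrite g_rec // -/f (_ : n - 1 - dm T = n - dm T - 1)%N; last by lia.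
apply: trunc_antisym => //; first by rewrite subn_gt0.
  rewrite AE; apply: (leq_trans (size_sum _ _ _)); apply/bigmax_leqP => H /andP[fH TH].
  apply: leq_trans (size_polyMleq _ _) _.
  rewrite (size_exp_XsubC _ (1 : int)) addnS /=.
  have := size_g fH; have := dm_lt fT fH TH; have := dm_le fH faceT (finset.subsetT H).
  rewrite dmT; move: (size _) (dm H) (dm T) => a b d; clear; lia.
move=> y y0; rewrite !pevA mulr_sumr.
have step H : faceb H && (T \proper H) ->
    y ^+ (n - dm T) * (int_horner (g H) y^-1 * (y^-1 - 1) ^+ (dm H - dm T)) =
    \sum_(L | faceb L && (T \proper L)) (if H \subset L then
      (-1) ^+ (dm H - dm T) * (int_horner (g L) y * (y - 1) ^+ (dm L - dm T)) else 0).
  move=> /andP[fH TH]; have dTH := dm_lt fT fH TH.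
  have dHn : (dm H <= n)%N by rewrite -dmT dm_le // finset.subsetT.
  have -> : y ^+ (n - dm T) = y ^+ (n - dm H) * y ^+ (dm H - dm T).
    by rewrite -exprD; congr (_ ^+ _); lia.
  rewrite mulrACA IH //; last by move: cT; lia.
  rewrite -exprMn mulrBr mulfV // mulr1.
  have -> : (1 - y) ^+ (dm H - dm T) = (-1) ^+ (dm H - dm T) * (y - 1) ^+ (dm H - dm T).
    by rewrite -exprMn mulN1r opprB.
  rewrite -big_mkcondr /= mulr_suml; apply: eq_big => [L|L /andP[fL HL]].
    case: (boolP (H \subset L)) => HL; rewrite ?andbF // !andbT.
    by rewrite (fintype.proper_sub_trans TH HL) andbT.
  have := dm_le fH fL HL => dHL.
  have -> : (y - 1) ^+ (dm L - dm T) = (y - 1) ^+ (dm L - dm H) * (y - 1) ^+ (dm H - dm T).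
    by rewrite -exprD; congr (_ ^+ _); lia.
  by ring.
rewrite (eq_bigr _ step) exchange_big /= -sumrN; apply: eq_bigr => L /andP[fL TL].
rewrite -big_mkcondr /= -mulr_suml -[RHS]mulN1r; congr (_ * _).
have := euler fT fL TL.
rewrite (bigD1 T) /=; last by rewrite fT fintype.subxx fintype.proper_sub.
move/eqP; rewrite addrC addr_eq0 => /eqP E.
apply: (@mulIf _ ((-1) ^+ dm T)); first by rewrite signr_eq0.
rewrite mulN1r -E mulr_suml; apply: eq_big => [H|H /andP[/andP[fH TH] _]].
  rewrite finset.properEneq eq_sym; case: (faceb H) => //=; case: (H == T); rewrite ?andbF ?andbT //.
by rewrite -exprD subnK // ltnW // dm_lt.
Qed.

End GPolynomial.

(** * The polytope and its cone *)

Section PolytopeCone.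
Variables (R : realType) (n k : nat) (v : 'I_k.+1 -> 'rV[R]_n).
Implicit Types T E F : {set 'I_k.+1}.

Local Notation W := (homog_mx v).

Lemma mul_homog_mx (y : 'cV[R]_(1 + n)) i :
  (W *m y) i 0 = usubmx y 0 0 + dotv (dsubmx y)^T (v i).
Proof.
have -> : (W *m y) i 0 = (row i W *m y) 0 0 by rewrite -row_mul [RHS]mxE.
by rewrite rowK -{1}(vsubmxK y) mul_row_col mul1mx mxE /dotv trmxK.
Qed.

(** If c has maximum M on the points v i, then M - c is a nonnegative affine function with zero set
    T; affine functions of v i are linear in the row (1, v i). *)
Lemma is_faceP T : is_face v T <-> T != finset.set0 /\ conic_face W T.
Proof.
split=> [[c TE]|[T0 [y Hy]]].
  pose i0 : 'I_k.+1 := [arg max_(i > ord0) dotv c (v i)]%O.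
  have Hi0 j : dotv c (v j) <= dotv c (v i0).
    by rewrite /i0; case: arg_maxP => // i _; exact.
  have memT i : (i \in T) = (dotv c (v i) == dotv c (v i0)).
    rewrite TE inE; apply/forallP/eqP => [H|-> j] //.
    by apply: le_anti; rewrite Hi0 H.
  split; first by apply/set0Pn; exists i0; rewrite memT.
  exists (col_mx (dotv c (v i0))%:M (- c^T)) => i.
  rewrite mul_homog_mx col_mxKu col_mxKd mxE eqxx mulr1n linearN /= trmxK.
  have -> : dotv (- c) (v i) = - dotv c (v i) by rewrite /dotv linearN mulmxN mxE.
  by rewrite subr_ge0 Hi0 subr_eq0 eq_sym memT.
have /set0Pn[i0 i0T] := T0.
exists (- (dsubmx y)^T); apply/setP => i; rewrite inE.
have yE j : dotv (- (dsubmx y)^T) (v j) = usubmx y 0 0 - (W *m y) j 0.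
  by rewrite mul_homog_mx opprD addrA subrr add0r /dotv linearN mulmxN mxE.
rewrite -(Hy i).2; apply/eqP/forallP => [yi j|H].
  by rewrite !yE yi subr0 lerBlDr lerDl (Hy j).1.
apply/eqP; rewrite eq_le (Hy i).1 andbT.
have := H i0; rewrite !yE (_ : (W *m y) i0 0 = 0); first by rewrite lerD2l lerN2.
by apply/eqP; rewrite (Hy i0).2.
Qed.

Lemma facebP T : faceb v T = (T != finset.set0) && `[< conic_face W T >].
Proof.
rewrite /faceb; apply/asboolP/andP => [/is_faceP[T0 fT]|[T0 /asboolP fT]].
  by split=> //; apply/asboolP.
by apply/is_faceP.
Qed.

Lemma affdimE T : affdim v T = (\rank (span_mx W T)).-1.
Proof.
rewrite /affdim; congr (_.-1); congr mxrank; apply/row_matrixP => i.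
rewrite rowK /span_mx /mask_mx mul_diag_mx.
apply/rowP => j; rewrite !mxE; case: (i \in T); rewrite ?mul1r ?mul0r ?mxE //.
Qed.

Lemma affdimS T : T != finset.set0 -> (affdim v T).+1 = \rank (span_mx W T).
Proof.
move=> /set0Pn[i iT]; rewrite affdimE prednK //.
exact: (span_mx_rank_gt0 (homog_mx_height v) iT).
Qed.

Lemma faceb_setT : faceb v finset.setT.
Proof.
apply/asboolP; exists 0; apply/setP => i; rewrite !inE; apply/esym/forallP => j.
by rewrite /dotv trmx0 !mulmx0.
Qed.

Lemma affdim_lt E F : faceb v E -> faceb v F -> E \proper F ->
  (affdim v E < affdim v F)%N.
Proof.
rewrite !facebP => /andP[E0 /asboolP fE] /andP[F0 _] EF.
by rewrite -ltnS !affdimS //; exact: face_rank fE EF.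
Qed.

Lemma in_dilate_cone (B : 'M[R]_n) T q z : (0 < q)%N ->
  in_dilate v q%:R T (lat B z) <-> cone W T (homog_pt B q%:Z z).
Proof.
move=> q0; have qR : (q%:R : R) != 0 by rewrite pnatr_eq0 -lt0n.
have comb l : l *m W = row_mx ((\sum_i l 0 i)%:M : 'rV_1) (\sum_i l 0 i *: v i).
  rewrite -[LHS]hsubmxK mulmx_sum_row; congr row_mx.
    rewrite linear_sum raddf_sum /=; apply: eq_bigr => i _.
    by rewrite linearZ /= rowK row_mxKl scalemx1.
  rewrite linear_sum /=; apply: eq_bigr => i _.
  by rewrite linearZ /= rowK row_mxKr.
split=> [[lam [l0 sl l1 E]]|[l [l0 sl]]].
  exists (\row_i (q%:R * lam i)); split.
  - by move=> i; rewrite mxE mulr_ge0 ?ler0n.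
  - by move=> i /sl; rewrite mxE => ->; rewrite mulr0.
  rewrite comb /homog_pt E; congr (row_mx _%:M _).
    by rewrite (eq_bigr (fun i => q%:R * lam i)) => [|i _]; rewrite ?mxE // -mulr_sumr l1 mulr1.
  by rewrite scaler_sumr; apply: eq_bigr => i _; rewrite mxE scalerA.
rewrite comb => /eq_row_mx[/matrixP/(_ 0 0)]; rewrite !mxE !eqxx !mulr1n => E1 E2.
exists (fun i => q%:R^-1 * l 0 i); split.
- by move=> i; rewrite mulr_ge0 ?invr_ge0 ?ler0n.
- by move=> i /sl ->; rewrite mulr0.
- by rewrite -mulr_sumr -E1 mulVf.
- rewrite E2 scaler_sumr; apply: eq_bigr => i _.
  by rewrite scalerA mulrA mulfV // mul1r.
Qed.

End PolytopeCone.

(** * The polynomial weight on integer coordinates *)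

Section Weights.
Variables (R : realType) (n k : nat) (B : 'M[R]_n) (phi : {mpoly R[i][n]}).

Definition weight (z : 'rV[int]_n) : R[i] := phi_eval phi (lat B z).

Lemma weightE z : weight z =
  \sum_(m <- msupp phi) phi@_m * \prod_i ((lat B z) 0 i)%:C%C ^+ m i.
Proof. by rewrite /weight /phi_eval mevalE. Qed.

Lemma polfun_weight : polfun weight.
Proof.
apply: (@polfun_eq _ _ (fun z => \sum_(m <- msupp phi)
   phi@_m * \prod_i ((lat B z) 0 i)%:C%C ^+ m i)).
  by move=> z; rewrite weightE.
apply: polfun_sum => m _; apply: polfunM; first exact: polfun_cst.
apply: polfun_prod => i _; apply: polfunX; apply: polfun_additive => x y.
by rewrite latD mxE rmorphD.
Qed.

Lemma weightN d z : phi \is d.-homog -> weight (- z) = (-1) ^+ d * weight z.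
Proof.
move=> /dhomogP hom; rewrite !weightE mulr_sumr big_seq [RHS]big_seq.
apply: eq_bigr => m /hom /= md; rewrite mulrCA; congr (_ * _).
rewrite -[in RHS]md mdegE -prodrXr -big_split /=; apply: eq_bigr => i _.
by rewrite latN mxE rmorphN [LHS]exprNn.
Qed.

Variable v : 'I_k.+1 -> 'rV[R]_n.
Hypothesis B_unit : B \in unitmx.

Lemma ehr_sumE T q : (0 < q)%N ->
  ehr_sum v B phi T q = fsum (fun z => cone_ind R[i] B v T q%:Z z * weight z).
Proof.
move=> q0; pose X := [set z | in_dilate v q%:R T (lat B z)]%classic.
rewrite /ehr_sum (_ : [set m | _ /\ _]%classic = (lat B @` X)%classic); last first.
  apply/seteqP; split=> m /= [].
    by move=> [z ->] Hz; exists z.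
  by move=> z Hz <-; split=> //; exists z.
rewrite fsbig_image; last by move=> x y _ _; exact: lat_inj.
rewrite (@fsum_on _ _ X) => [|z].
  apply: eq_fsbigr => z; rewrite inE => /(in_dilate_cone v B T z q0) Hz.
  rewrite /cone_ind; have -> : `[< cone (homog_mx v) T (homog_pt B q%:Z z) >] by apply/asboolP.
  by rewrite mul1r.
rewrite /cone_ind; case: asboolP => [Hz _|]; last by rewrite mul0r eqxx.
exact/(in_dilate_cone v B T z q0).
Qed.

End Weights.

(** Recursive calls pass to strictly larger sets, so the number of indices missing from T bounds the
    depth. *)
Lemma gt_fuel_rec (R : realType) (n k : nat) (v : 'I_k.+1 -> 'rV[R]_n)
    (T : {set 'I_k.+1}) fuel : (k.+1 - #|T| < fuel)%N -> gt_fuel v fuel T = gtilde v T.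
Proof.
rewrite /gtilde.
have H f1 f2 (T' : {set 'I_k.+1}) : (k.+1 - #|T'| < f1)%N -> (k.+1 - #|T'| < f2)%N ->
    gt_fuel v f1 T' = gt_fuel v f2 T'.
  elim: f1 f2 T' => // f1 IH [//|f2] T' H1 H2 /=; case: eqP => // _.
  congr trunc_g; apply: eq_bigr => E /andP[_ TE]; congr (_ * _).
  have lt := proper_card TE; have := max_card E; rewrite card_ord => Ek.
  by apply: IH; [move: H1|move: H2]; move: lt Ek; clear; lia.
by move=> Hf; apply: H => //; rewrite ltnS (leq_trans (leq_subr _ _)).
Qed.

Lemma gtilde_rec (R : realType) (n k : nat) (v : 'I_k.+1 -> 'rV[R]_n)
    (T : {set 'I_k.+1}) : T != finset.setT ->
  gtilde v T = trunc_g (n - 1 - affdim v T)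
    (\sum_(H | faceb v H && (T \proper H))
       gtilde v H * ('X - 1) ^+ (affdim v H - affdim v T - 1)).
Proof.
move=> /negPf TT; suff H fuel : (k.+1 <= fuel)%N -> gt_fuel v fuel.+1 T = trunc_g (n - 1 - affdim v T)
    (\sum_(H | faceb v H && (T \proper H))
       gtilde v H * ('X - 1) ^+ (affdim v H - affdim v T - 1)) by exact: (H k.+1).
move=> kf /=; rewrite TT; congr trunc_g.
apply: eq_bigr => E /andP[_ /proper_card TE]; congr (_ * _); apply: gt_fuel_rec.
by move: TE kf; clear; lia.
Qed.

(** The last rearrangement of the main proof, with letters for the powers so that [ring] need not
    expand them; the single relation u w = 1 is the cancellation of (-y)^(n - dim T) against
    (-1/y)^(n - dim T). *)
Lemma mul_cancel_shuffle (A : comNzRingType) (p1 u w p2 q1 q2 s1 s2 b c : A) :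
  u * w = 1 ->
  p1 * u * p2 * q2 * (q1 * w * b * (s1 * s2 * c)) =
  p2 * q2 * s2 * (p1 * q1 * s1 * b * c).
Proof. by move=> uw; rewrite -[RHS]mul1r -uw; ring. Qed.

(** * Comparison of the two sides at positive integers *)

Theorem theorem2p3 (R : realType) (n k : nat) (B : 'M[R]_n)
    (v : 'I_k.+1 -> 'rV[R]_n) (phi : {mpoly R[i][n]}) (d : nat)
    (D : {set 'I_k.+1} -> {poly R[i]}) :
  B \in unitmx ->
  (forall i, in_lattice B (v i)) ->
  affdim v finset.setT = n ->
  phi != 0 ->
  phi \is d.-homog ->
  (forall T, is_face v T -> forall q : nat, (0 < q)%N ->
     (D T).[q%:R] = ehr_sum v B phi T q) ->
  forall q y : R[i], y != 0 ->
    Gfun v d D q y = (- y) ^+ (n + d) * Gfun v d D (- q) y^-1.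
Proof.
move=> B_unit v_lat dimT _ homphi HD q y y0.
have [zs zsE] := choice v_lat.
pose W := homog_mx v; pose F := faceb v : pred {set 'I_k.+1}; pose dm := affdim v.
pose g (T : {set 'I_k.+1}) := int_horner (gtilde v T) : R[i] -> R[i].
pose a (T : {set 'I_k.+1}) (q : nat) := fsum (fun z => relint_ind R[i] B v T q%:Z z * weight B phi z).
have polw := polfun_weight B phi.
(* [D T] is prescribed at positive integers only; polynomiality carries its agreement with [ehr]
   over to negative ones. *)
have De (T : {set 'I_k.+1}) : F T -> forall s : int, (D T).[s%:~R] = ehr B v T (weight B phi) s.
  move=> fT; apply: (@polfun_ext _ (fun s : int => (D T).[s%:~R])).
  - exact: polfun_horner.
  - exact: (polfun_ehr B_unit zsE).
  move=> s s0; rewrite ehr_pos // -ehr_sumE // -HD //.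
  by apply/asboolP.
have conicF (T : {set 'I_k.+1}) : F T -> conic_face W T by rewrite /F facebP => /andP[_ /asboolP].
have Dpos (T : {set 'I_k.+1}) (s : nat) : F T -> (0 < s)%N ->
    (D T).[s%:R] = \sum_(E : {set 'I_k.+1} | F E && (E \subset T)) a E s.
  move=> fT s0; rewrite [s%:R](_ : _ = s%:Z%:~R) // De // ehr_pos //.
  rewrite (eq_bigr (fun E : {set 'I_k.+1} => a E s)) // /a -fsum_sum; last first.
    by move=> E _; apply: fsuppMr; exact: (relint_ind_fin _ B_unit zsE).
  apply: fsum_eq => z; rewrite (cone_ind_faces _ _ _ (conicF T fT)) // mulr_suml.
  (* The empty set is a [conic_face] but not a face of the polytope. Its relative interior is the
     apex, at height 0, while s > 0. *)
  rewrite [LHS](bigID (fun E : {set 'I_k.+1} => E != finset.set0)) /=.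
  rewrite [X in _ + X]big1 ?addr0 => [|E /andP[_ /negPn/eqP ->]].
    by apply: eq_bigl => E; rewrite /F facebP andbC andbA.
  rewrite /relint_ind; case: asboolP => [[l [_ sl]]|]; last by rewrite mul0r.
  have -> : l = 0 by apply/rowP => i; rewrite sl ?inE // mxE.
  rewrite mul0mx => E0; have := homog_pt_height B s%:Z z; rewrite E0 mul0mx mxE.
  by move=> /esym/eqP; rewrite intr_eq0 eqz_nat => /eqP s00; rewrite s00 in s0.
have rkT (T : {set 'I_k.+1}) : F T -> \rank (span_mx W T) = (dm T).+1.
  by rewrite /F facebP => /andP[T0 _]; rewrite -affdimS.
have Dneg (T : {set 'I_k.+1}) (s : nat) : F T -> (0 < s)%N -> (D T).[- s%:R] = (-1) ^+ (dm T + d) * a T s.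
  move=> fT s0; rewrite [- s%:R](_ : _ = (- s%:Z)%:~R); last by rewrite mulrNz.
  rewrite (De T fT) (ehr_neg B v T _ s0) (rkT T fT).
  rewrite exprS mulN1r opprK exprD -mulrA; congr (_ * _); rewrite -fsumMl.
  by apply: fsum_eq => z; rewrite (weightN _ _ homphi) mulrCA.
have dm_lt (E T : {set 'I_k.+1}) : F E -> F T -> E \proper T -> (dm E < dm T)%N by exact: affdim_lt.
have gE (T : {set 'I_k.+1}) : F T -> forall x, x != 0 ->
    g T x = \sum_(H : {set 'I_k.+1} | F H && (T \subset H)) g H x^-1 * (x ^+ (n - dm H) * (1 - x) ^+ (dm H - dm T)).
  move=> fT x x0; have xV0 : x^-1 != 0 by rewrite invr_eq0.
  have := @g_reciprocity R[i] _ F dm n dimT (faceb_setT v) dm_lt _ (gtilde v) _ _ T fT _ xV0.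
  rewrite invrK -/(g T) => Hg.
  have -> : g T x = x ^+ (n - dm T) * (x^-1 ^+ (n - dm T) * g T x).
    by rewrite mulrA -exprMn divff // expr1n mul1r.
  rewrite Hg.
  - rewrite mulr_sumr; apply: eq_bigr => H /andP[fH TH]; rewrite mulrCA; congr (_ * _).
    have dTH : (dm T <= dm H)%N by apply: dm_le dm_lt _ _ fT fH TH.
    have dHn : (dm H <= n)%N.
      by rewrite -dimT; apply: dm_le dm_lt _ _ fH (faceb_setT v) (finset.subsetT H).
    have -> : x ^+ (n - dm T) = x ^+ (n - dm H) * x ^+ (dm H - dm T).
      by rewrite -exprD; congr (_ ^+ _); move: dTH dHn; clear; lia.
    by rewrite -mulrA -exprMn mulrBr divff // mulr1.
  (* [face_euler] takes signs from the rank of the cone over a face, one more than the dimension of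
     the face; hence the factor -1. *)
  - move=> G H fG fH GH; apply: (@mulfI _ (-1)); first by rewrite oppr_eq0 oner_eq0.
    have G0 : G != finset.set0 by move: fG; rewrite /F facebP => /andP[].
    rewrite mulr0 -[RHS](face_euler R[i] B_unit zsE (conicF G fG) (conicF H fH) G0 GH) mulr_sumr.
    apply: eq_big => E.
      rewrite /F facebP; case: (boolP (G \subset E)); rewrite ?andbF // => GE.
      suff -> : E != finset.set0 by [].
      by apply: contraNneq G0 => E0; rewrite E0 finset.subset0 in GE.
    by move=> /and3P[fE _ _]; rewrite -exprS -rkT.
  - by rewrite /gtilde /= eqxx.
  - by move=> T' _ T'T; exact: gtilde_rec.
(* For fixed y both sides are polynomials in q, so they may be compared at positive integers, where
   [Dpos] and [Dneg] apply. *)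
pose P1 := ((y + 1) ^+ d)%:P * \sum_(T : {set 'I_k.+1} | F T)
  ((y + 1) ^+ dm T * (- y) ^+ (n - dm T) * g T (- y^-1)) *: D T.
pose P2 := ((- y) ^+ (n + d) * (y^-1 + 1) ^+ d)%:P * \sum_(T : {set 'I_k.+1} | F T)
  ((y^-1 + 1) ^+ dm T * (- y^-1) ^+ (n - dm T) * g T (- y)) *: (D T \Po (- 'X)).
have P1E x : P1.[x] = Gfun v d D x y.
  rewrite /P1 hornerM hornerC horner_sum; congr (_ * _); apply: eq_bigr => T _.
  by rewrite hornerZ mulrAC.
have P2E x : P2.[x] = (- y) ^+ (n + d) * Gfun v d D (- x) y^-1.
  rewrite /P2 hornerM hornerC horner_sum /Gfun mulrA; congr (_ * _).
  by apply: eq_bigr => T _; rewrite hornerZ horner_comp !hornerE invrK mulrAC.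
rewrite -P1E -P2E; congr (_.[q]); apply: poly_eq_nat => {q} s s0.
have yE : - y^-1 = (- y)^-1 by rewrite invrN.
have t0 : - y != 0 by rewrite oppr_eq0.
have dmn (T : {set 'I_k.+1}) : F T -> (dm T <= n)%N.
  by move=> fT; rewrite -dimT; apply: dm_le dm_lt _ _ fT (faceb_setT v) (finset.subsetT T).
(* The common value of the two sides: on the left, exchanging the sums leaves for each E Stanley's
   identity [gE] at -y. *)
transitivity ((y + 1) ^+ d * \sum_(E : {set 'I_k.+1} | F E) (y + 1) ^+ dm E * g E (- y) * a E s).
  rewrite /P1 hornerM hornerC horner_sum; congr (_ * _).
  rewrite (eq_bigr (fun T : {set 'I_k.+1} => \sum_(E : {set 'I_k.+1} | F E && (E \subset T))
     (y + 1) ^+ dm T * (- y) ^+ (n - dm T) * g T (- y^-1) * a E s)); last first.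
    by move=> T fT; rewrite hornerZ Dpos // mulr_sumr.
  rewrite (exchange_big_dep F) /=; last by move=> T E _ /andP[].
  apply: eq_bigr => E fE; rewrite -mulr_suml; congr (_ * _).
  rewrite (gE E fE _ t0) mulr_sumr -yE; apply: eq_big => T; first by rewrite fE.
  move=> /andP[fT /andP[_ ET]].
  have dET : (dm E <= dm T)%N by apply: dm_le dm_lt _ _ fE fT ET.
  rewrite opprK [1 + y]addrC.
  have -> : (y + 1) ^+ dm T = (y + 1) ^+ dm E * (y + 1) ^+ (dm T - dm E).
    by rewrite -exprD subnKC.
  rewrite -!mulrA; congr (_ * _); rewrite mulrA mulrC; congr (_ * _); exact: mulrC.
rewrite /P2 hornerM hornerC horner_sum !mulr_sumr; apply: eq_bigr => T fT.
rewrite hornerZ horner_comp hornerN hornerX Dneg //.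
(* From y + 1 = (-y) (1/y + 1) (-1): these powers account for the signs in [Dneg] and for the powers
   of -y in front. *)
have yp e : (y + 1) ^+ e = (- y) ^+ e * (y^-1 + 1) ^+ e * (-1) ^+ e.
  by rewrite -!exprMn mulrN1 mulNr opprK mulrDr divff // mulr1 addrC.
have yV : (- y) ^+ (n - dm T) * (- y^-1) ^+ (n - dm T) = 1.
  by rewrite -exprMn mulrNN divff // expr1n.
have -> : (- y) ^+ (n + d) = (- y) ^+ dm T * (- y) ^+ (n - dm T) * (- y) ^+ d.
  by rewrite -!exprD subnKC // dmn.
rewrite !yp exprD; move: yV; set u := (- y) ^+ (n - dm T); set w := (- y^-1) ^+ (n - dm T).
by move=> /(mul_cancel_shuffle ((- y) ^+ dm T)) ->.
Qed.
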